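(* Let $K$ be a field, $Q$ a quiver, $\boldsymbol{\underline d}=(\underline d^0,\dots,\underline d^\nu)$ a filtration, $F$ a field extension of $K$, $\Lambda:=(FQ)A_{\nu+1}$ and $(M,\boldsymbol{U})\in\mathrm{RepFl}_Q(\boldsymbol{\underline d})(F)$. Let $\boldsymbol{M}=(M=M=\dots=M)$ as a $\Lambda$-module. Then $$\operatorname{codim}\mathcal{A}_{\boldsymbol{\underline d}}\le\dim_F\mathrm{Ext}^1_\Lambda(\boldsymbol{U},\boldsymbol{M}/\boldsymbol{U})\le\dim_F\mathrm{Ext}^1_\Lambda(\boldsymbol{U},\boldsymbol{M})\le\dim_F\mathrm{Ext}^1_{FQ}(M,M).$$
   Context: $Q$ is a finite quiver; $\mathrm{Rep}_Q(\underline d)=\prod_{\alpha:i\to j}\mathrm{Hom}(d_i,d_j)$ is the affine space (as a $K$-scheme) of representations of dimension vector $\underline d$. A filtration is a sequence of dimension vectors with $\underline d^0=0$ and $\underline d^i\le\underline d^{i+1}$ for all $i$. $\mathrm{Fl}(\boldsymbol{\underline d})$ is the scheme of flags: its $R$-points are sequences $U^0\subset\dots\subset U^\nu$ of ($Q_0$-graded) submodules of $\bigoplus_iR^{d^\nu_i}$ with $U^k_i$ a direct summand of $R^{d^\nu_i}$ of rank $d^k_i$. $\mathrm{RepFl}_Q(\boldsymbol{\underline d})\subset\mathrm{Rep}_Q(\underline d^\nu)\times\mathrm{Fl}(\boldsymbol{\underline d})$ is the closed subscheme of pairs $(M,\boldsymbol U)$ such that every $U^k$ is a subrepresentation of $M$.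 $\mathcal{A}_{\boldsymbol{\underline d}}$ is the (scheme-theoretic) image of $\mathrm{RepFl}_Q(\boldsymbol{\underline d})$ under the first projection to $\mathrm{Rep}_Q(\underline d^\nu)$, a closed irreducible subvariety; its codimension is taken in $\mathrm{Rep}_Q(\underline d^\nu)$. $A_{\nu+1}$ is the linearly oriented quiver $0\to1\to\dots\to\nu$, and $(FQ)A_{\nu+1}$ is its path algebra with coefficients in $FQ$; its modules are sequences $M^0\to M^1\to\dots\to M^\nu$ of $F$-representations of $Q$, with morphisms the commuting diagrams. A flag $\boldsymbol{U}=(U^0\subset\dots\subset U^\nu)$ is regarded as a $\Lambda$-submodule of the constant sequence $\boldsymbol{M}$ with identity maps. *)

(* Defs.v *)
From HB Require Import structures.
From mathcomp Require Import all_boot all_order all_algebra.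
From mathcomp Require Import generic_quotient mpoly.

Set Implicit Arguments.
Unset Strict Implicit.
Unset Printing Implicit Defensive.

Import GRing.Theory.
Local Open Scope ring_scope.
Local Open Scope quotient_scope.

Section Submodule.
Variables (R : nzRingType) (V : lmodType R) (S : submodClosed V).

Definition subm : Type := {x : V | x \in S}.
HB.instance Definition _ := SubType.on subm.
HB.instance Definition _ := [Choice of subm by <:].
HB.instance Definition _ := [SubChoice_isSubLmodule of subm by <:].

Definition subm_incl (x : subm) : V := val x.
Fact subm_incl_is_linear : linear subm_incl.
Proof. by []. Qed.
HB.instance Definition _ :=
  GRing.isLinear.Build R subm V _ subm_incl subm_incl_is_linear.

End Submodule.

Section SubmoduleMap.
Variables (R : nzRingType) (V W : lmodType R).
Variables (S : submodClosed V) (T : submodClosed W) (f : {linear V -> W}).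
Hypothesis fST : forall x, x \in S -> f x \in T.

Definition subm_map (x : subm S) : subm T :=
  exist _ (f (val x)) (fST (valP x)).
Fact subm_map_is_linear : linear subm_map.
Proof. by move=> a x y; apply: val_inj; rewrite /= linearP. Qed.
HB.instance Definition _ :=
  GRing.isLinear.Build R (subm S) (subm T) _ subm_map subm_map_is_linear.

End SubmoduleMap.

Section QuotientModule.
Variables (R : nzRingType) (V : lmodType R) (S : submodClosed V).

Definition subm_zmod : {pred V} := fun x => x \in S.
Fact subm_zmod_closed : zmod_closed subm_zmod.
Proof. exact: GRing.submod_closedB (submodClosedP S). Qed.
HB.instance Definition _ :=
  GRing.isZmodClosed.Build V subm_zmod subm_zmod_closed.

Definition qmod : Type := Quotient.quot subm_zmod.
HB.instance Definition _ := GRing.Zmodule.on qmod.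
HB.instance Definition _ := EqQuotient.on qmod.

Definition qmod_pi (x : V) : qmod := \pi_(Quotient.quot subm_zmod) x.

Definition qmod_scale (a : R) (q : qmod) : qmod := qmod_pi (a *: repr q).

Lemma qmod_piP (x y : V) : reflect (qmod_pi x = qmod_pi y) (x - y \in S).
Proof.
have -> : (x - y \in S) = (x - y \in subm_zmod) by [].
by rewrite Quotient.idealrBE; apply: eqP.
Qed.

Lemma qmod_reprK (q : qmod) : qmod_pi (repr q) = q.
Proof. exact: reprK. Qed.

Fact qmod_pi_is_zmod_morphism : zmod_morphism qmod_pi.
Proof. by move=> x y; rewrite /qmod_pi !piE. Qed.
HB.instance Definition _ :=
  GRing.isZmodMorphism.Build V qmod qmod_pi qmod_pi_is_zmod_morphism.

Lemma qmod_scaleE a x : qmod_scale a (qmod_pi x) = qmod_pi (a *: x).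
Proof.
apply/qmod_piP; rewrite -scalerBr rpredZ //.
by apply/qmod_piP; rewrite qmod_reprK.
Qed.

Fact qmod_scaleA a b q :
  qmod_scale a (qmod_scale b q) = qmod_scale (a * b) q.
Proof. by rewrite -[q]qmod_reprK !qmod_scaleE scalerA. Qed.
Fact qmod_scale1 : left_id 1 qmod_scale.
Proof. by move=> q; rewrite -[q]qmod_reprK qmod_scaleE scale1r. Qed.
Fact qmod_scaleDr : right_distributive qmod_scale +%R.
Proof.
move=> a p q; rewrite -[p]qmod_reprK -[q]qmod_reprK -raddfD !qmod_scaleE.
by rewrite scalerDr raddfD.
Qed.
Fact qmod_scaleDl q : {morph qmod_scale^~ q : a b / a + b}.
Proof.
by move=> a b; rewrite -[q]qmod_reprK !qmod_scaleE scalerDl raddfD.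
Qed.
HB.instance Definition _ := GRing.Zmodule_isLmodule.Build R qmod
  qmod_scaleA qmod_scale1 qmod_scaleDr qmod_scaleDl.

Fact qmod_pi_is_scalable : scalable qmod_pi.
Proof. by move=> a x; rewrite -qmod_scaleE. Qed.
HB.instance Definition _ :=
  GRing.isScalable.Build R V qmod _ qmod_pi qmod_pi_is_scalable.

End QuotientModule.

Section QuotientMap.
Variables (R : nzRingType) (V W : lmodType R).
Variables (S : submodClosed V) (T : submodClosed W) (f : {linear V -> W}).

Definition qmod_map (fST : forall x, x \in S -> f x \in T) (q : qmod S) :
  qmod T := qmod_pi T (f (repr q)).

Hypothesis fST : forall x, x \in S -> f x \in T.

Lemma qmod_mapE x : qmod_map fST (qmod_pi S x) = qmod_pi T (f x).
Proof.
apply/qmod_piP; rewrite -linearB; apply: fST.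
by apply/qmod_piP; rewrite qmod_reprK.
Qed.

Fact qmod_map_is_linear : linear (qmod_map fST).
Proof.
move=> a p q; rewrite -[p]qmod_reprK -[q]qmod_reprK -linearP !qmod_mapE.
by rewrite !linearP.
Qed.
HB.instance Definition _ :=
  GRing.isLinear.Build R (qmod S) (qmod T) _ (qmod_map fST) qmod_map_is_linear.

End QuotientMap.

Record quiver : Type := Quiver {
  vert : finType;
  arr : finType;
  src : arr -> vert;
  tgt : arr -> vert }.

Section Representations.
Variables (F : fieldType) (Q : quiver).

Record qrep : Type := QRep {
  qsp :> vert Q -> lmodType F;
  qmor : forall a : arr Q, {linear qsp (src a) -> qsp (tgt a)} }.

Record qhom (M N : qrep) : Type := QHom {
  qhom_fun :> forall i : vert Q, {linear M i -> N i};
  qhom_comm : forall (a : arr Q) (x : M (src a)),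
    qhom_fun (tgt a) (qmor M a x) = qmor N a (qhom_fun (src a) x) }.

Definition qhom_id (M : qrep) : qhom M M :=
  @QHom M M (fun i => idfun : {linear M i -> M i}) (fun a x => erefl).

Variable nu : nat.

Definition step_src (k : 'I_nu) : 'I_nu.+1 := widen_ord (leqnSn nu) k.
Definition step_tgt (k : 'I_nu) : 'I_nu.+1 := lift ord0 k.

(* A module over the path algebra (FQ)A_(nu+1) of 0 -> 1 -> ... -> nu with    *)
(* coefficients in FQ: a sequence M^0 -> M^1 -> ... -> M^nu in Rep_F(Q).      *)
Record qseq : Type := QSeq {
  qseq_obj :> 'I_nu.+1 -> qrep;
  qseq_step : forall k : 'I_nu,
    qhom (qseq_obj (step_src k)) (qseq_obj (step_tgt k)) }.

Record qseq_hom (X Y : qseq) : Type := QSeqHom {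
  qseq_hom_fun :> forall k : 'I_nu.+1, qhom (X k) (Y k);
  qseq_hom_comm :
    forall (k : 'I_nu) (i : vert Q) (x : X (step_src k) i),
      qseq_hom_fun (step_tgt k) i (qseq_step X k i x) =
      qseq_step Y k i (qseq_hom_fun (step_src k) i x) }.

Definition const_qseq (M : qrep) : qseq :=
  QSeq (fun k : 'I_nu => qhom_id M : qhom ((fun=> M) (step_src k)) M).

Section SubQuotient.
Variable X : qseq.

Record subqseq : Type := SubQSeq {
  sub_sp :> forall (k : 'I_nu.+1) (i : vert Q), submodClosed (X k i);
  sub_arr : forall k (a : arr Q) (x : X k (src a)),
    x \in sub_sp k (src a) -> qmor (X k) a x \in sub_sp k (tgt a);
  sub_step : forall (k : 'I_nu) i (x : X (step_src k) i),
    x \in sub_sp (step_src k) i ->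
    qseq_step X k i x \in sub_sp (step_tgt k) i }.

Variable U : subqseq.

Definition sub_qrep (k : 'I_nu.+1) : qrep :=
  @QRep (fun i => subm (U k i)) (fun a => subm_map (@sub_arr U k a)).

Fact sub_step_comm (k : 'I_nu) (a : arr Q)
    (x : sub_qrep (step_src k) (src a)) :
  subm_map (@sub_step U k (tgt a)) (qmor (sub_qrep (step_src k)) a x) =
  qmor (sub_qrep (step_tgt k)) a (subm_map (@sub_step U k (src a)) x).
Proof. by apply: val_inj; apply: qhom_comm. Qed.

Definition sub_qseq : qseq :=
  @QSeq sub_qrep (fun k =>
    @QHom (sub_qrep (step_src k)) (sub_qrep (step_tgt k))
      (fun i => subm_map (@sub_step U k i)) (@sub_step_comm k)).

Definition quot_qrep (k : 'I_nu.+1) : qrep :=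
  @QRep (fun i => qmod (U k i)) (fun a => qmod_map (@sub_arr U k a)).

Fact quot_step_comm (k : 'I_nu) (a : arr Q)
    (x : quot_qrep (step_src k) (src a)) :
  qmod_map (@sub_step U k (tgt a)) (qmor (quot_qrep (step_src k)) a x) =
  qmor (quot_qrep (step_tgt k)) a (qmod_map (@sub_step U k (src a)) x).
Proof.
rewrite /= -[x]qmod_reprK qmod_mapE qmod_mapE qmod_mapE qmod_mapE.
by rewrite qhom_comm.
Qed.

Definition quot_qseq : qseq :=
  @QSeq quot_qrep (fun k =>
    @QHom (quot_qrep (step_src k)) (quot_qrep (step_tgt k))
      (fun i => qmod_map (@sub_step U k i)) (@quot_step_comm k)).

End SubQuotient.
End Representations.

(* The data of a category of representations used below: an object has a      *)
(* family of underlying F-vector spaces, a morphism a family of functions.    *)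
(* Exactness and F-linear combinations of morphisms are computed pointwise.   *)
Record module_cat (F : fieldType) : Type := ModuleCat {
  mobj : Type;
  midx : Type;
  msp : mobj -> midx -> lmodType F;
  mhom : mobj -> mobj -> Type;
  mapp : forall X Y : mobj, mhom X Y -> forall i : midx, msp X i -> msp Y i }.
Arguments mapp {F m X Y} f i x : rename.

Definition FQ_mod (F : fieldType) (Q : quiver) : module_cat F :=
  @ModuleCat F (qrep F Q) (vert Q) (@qsp F Q) (@qhom F Q)
    (fun M N f i x => f i x).

Definition FQA_mod (F : fieldType) (Q : quiver) (nu : nat) : module_cat F :=
  @ModuleCat F (qseq F Q nu) ('I_nu.+1 * vert Q)%type
    (fun X ki => X ki.1 ki.2) (@qseq_hom F Q nu)
    (fun X Y f ki x => f ki.1 ki.2 x).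

Section Ext.
Variables (F : fieldType) (C : module_cat F).
Implicit Types X Y P W : mobj C.

Definition msurj X Y (f : mhom X Y) : Prop :=
  forall i y, exists x, mapp f i x = y.

Definition projective P : Prop :=
  forall X Y (q : mhom X Y) (f : mhom P Y), msurj q ->
    exists g : mhom P X, forall i x, mapp q i (mapp g i x) = mapp f i x.

Definition short_exact W P X (j : mhom W P) (p : mhom P X) : Prop :=
  [/\ forall i, injective (mapp j i), msurj p &
      forall i x, mapp p i x = 0 <-> exists w, mapp j i w = x].

(* dim_F Ext^1(X, Y) = e.  For a projective presentation 0->W->P->X->0        *)
(* one has Ext^1(X, Y) = coker (Hom(P, Y) -> Hom(W, Y)); the classes of the   *)
(* f_k form an F-basis of it.                                                 *)
Definition ext1_dim X Y (e : nat) : Prop :=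
  exists W P (j : mhom W P) (p : mhom P X),
    [/\ projective P, short_exact j p &
    exists f : 'I_e -> mhom W Y, forall g : mhom W Y,
      exists! c : 'rV[F]_e, exists h : mhom P Y, forall i w,
        mapp g i w =
        \sum_(k < e) c 0 k *: mapp (f k) i w + mapp h i (mapp j i w)].

End Ext.
Arguments ext1_dim {F} C X Y e.

Record filtration (Q : quiver) (nu : nat) : Type := Filtration {
  fdim :> 'I_nu.+1 -> vert Q -> nat;
  fdim0 : forall i, fdim ord0 i = 0%N;
  fdimS : forall (k : 'I_nu) i,
    (fdim (step_src k) i <= fdim (step_tgt k) i)%N }.

(* An R-point of Rep_Q(d).  Vectors are rows, so the arrow a acts by          *)
(* x |-> x *m M a.                                                            *)
Definition rep_pt (R : Type) (Q : quiver) (d : vert Q -> nat) : Type :=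
  forall a : arr Q, 'M[R]_(d (src a), d (tgt a)).

Section Flags.
Variables (R : comNzRingType).

Definition direct_summand n (U : submodClosed 'rV[R]_n) : Prop :=
  exists W : submodClosed 'rV[R]_n,
    (forall x, exists u w, [/\ u \in U, w \in W & x = u + w]) /\
    (forall x, x \in U -> x \in W -> x = 0).

(* U has rank r if U (x)_R k has dimension r for every field-valued point     *)
(* R -> k.  For a direct summand U of R^n, this tensor product is the         *)
(* k-subspace of k^n spanned by the image of U.                               *)
Definition has_rank n (U : submodClosed 'rV[R]_n) (r : nat) : Prop :=
  forall (k : fieldType) (phi : {rmorphism R -> k}),
    exists B : 'M[R]_(r, n),
      [/\ forall i, row i B \in U, row_free (map_mx phi B) &
          forall u, u \in U -> (map_mx phi u <= map_mx phi B)%MS].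

(* The R-points (M, U) of RepFl_Q(d), with U = rf_flag.                       *)
Record repfl (Q : quiver) (nu : nat) (d : filtration Q nu) : Type := RepFl {
  rf_rep : rep_pt R (d ord_max);
  rf_flag : forall (k : 'I_nu.+1) (i : vert Q), submodClosed 'rV[R]_(d ord_max i);
  rf_summand : forall k i, direct_summand (rf_flag k i);
  rf_rank : forall k i, has_rank (rf_flag k i) (d k i);
  rf_incl : forall (k : 'I_nu) i,
    {subset rf_flag (step_src k) i <= rf_flag (step_tgt k) i};
  rf_stable : forall k (a : arr Q) (x : 'rV[R]_(d ord_max (src a))),
    x \in rf_flag k (src a) -> x *m rf_rep a \in rf_flag k (tgt a) }.

End Flags.

Section FieldPoint.
Variables (F : fieldType) (Q : quiver) (nu : nat) (d : filtration Q nu).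
Variable x : repfl F d.

Definition rf_qrep : qrep F Q :=
  @QRep F Q (fun i => 'rV[F]_(d ord_max i)) (fun a => mulmxr (rf_rep x a)).

Definition rf_sub : subqseq (const_qseq nu rf_qrep) :=
  @SubQSeq F Q nu (const_qseq nu rf_qrep) (rf_flag x) (@rf_stable _ _ _ _ x)
    (@rf_incl _ _ _ _ x).

End FieldPoint.

Definition rep_coord (Q : quiver) (d : vert Q -> nat) : finType :=
  {a : arr Q & ('I_(d (src a)) * 'I_(d (tgt a)))%type}.

Definition rep_ring (K : fieldType) (Q : quiver) (d : vert Q -> nat) :
    comNzRingType :=
  {mpoly K[#|rep_coord d|]}.

Definition rep_eval (K : fieldType) (R : comNzRingType)
    (phi : {rmorphism K -> R}) (Q : quiver) (d : vert Q -> nat)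
    (M : rep_pt R d) (f : rep_ring K d) : R :=
  mmap phi
    (fun t => let c := enum_val t in M (tag c) (tagged c).1 (tagged c).2) f.

(* The closed subscheme V(J) of Rep_Q(d^nu) contains the image of RepFl_Q(d)  *)
(* iff each f in J vanishes at (M, U) for all K-algebras R and all            *)
(* (M, U) in RepFl_Q(d)(R).  Hence the scheme-theoretic image is V(I) for the *)
(* following I.                                                               *)
Definition image_ideal (K : fieldType) (Q : quiver) (nu : nat)
    (d : filtration Q nu) (f : rep_ring K (d ord_max)) : Prop :=
  forall (R : comNzRingType) (phi : {rmorphism K -> R}) (x : repfl R d),
    rep_eval phi (rf_rep x) f = 0.
Arguments image_ideal K {Q nu} d f.

Section Codimension.
Variable S : comNzRingType.

(* A chain P_0 < P_1 < ... < P_n = P of primes, i.e. a chain of irreducible   *)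
(* closed subsets V(P) = V(P_n) < ... < V(P_0) of Spec S.                     *)
Definition prime_chain (P : prime_idealr S) (n : nat) : Prop :=
  exists p : nat -> prime_idealr S, p n =i P /\
    forall k, (k < n)%N ->
      {subset p k <= p k.+1} /\ exists2 s, s \in p k.+1 & s \notin p k.

Definition prime_codim (P : prime_idealr S) (c : nat) : Prop :=
  prime_chain P c /\ forall n, prime_chain P n -> (n <= c)%N.

(* The codimension of a closed subset is the infimum of the codimensions of   *)
(* the irreducible closed subsets it contains.                                *)
Definition is_codim (I : S -> Prop) (c : nat) : Prop :=
  (exists2 P : prime_idealr S, (forall s, I s -> s \in P) & prime_codim P c) /\
  (forall (P : prime_idealr S) c', (forall s, I s -> s \in P) ->
     prime_codim P c' -> (c <= c')%N).

End Codimension.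

(* Main.v *)
(* All three Ext groups come from the same two-term complex. The free         *)
(* representation P on X maps onto X, and homomorphisms out of the kernel of  *)
(* P -> X are the same as cochains (gamma_a : X_(src a) -> Y_(tgt a)) over    *)
(* the arrows a, the restrictions of homomorphisms P -> Y being the           *)
(* coboundaries Y_a phi - phi X_a. So Ext^1(X, Y) is the cokernel of this     *)
(* coboundary map as soon as each X_i is projective as a chain of vector      *)
(* spaces, and a flag is. Since cochains on U with values in bM or in bM / U  *)
(* lift to matrices, Ext^1(U, bM) and Ext^1(M, M) are both Rep / [gl, M],     *)
(* while Ext^1(U, bM / U) is Rep / (Rep_U + [gl, M]), where Rep_U is the      *)
(* space of representations that stabilise U.                                 *)
(*                                                                            *)
(* For the codimension, choose a basis of Rep_U + [gl, M] and deform (M, U)   *)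
(* along all basis vectors at once, with independent parameters, by M + s sum *)
(* t_l B_l followed by the base change 1 + s sum t_l X_l. This is a point of  *)
(* RepFl over the field F(t, s), and the kernel of evaluation at it is a      *)
(* prime P of the coordinate ring of Rep above the ideal of the image.        *)
(* Comparing lowest terms in s shows that r = dim (Rep_U + [gl, M]) of the    *)
(* coordinates are algebraically independent modulo P; in a chain of primes   *)
(* below P each step adds one more independent element, so the height of P is *)
(* at most N - r with N = dim Rep. Lowest terms replace the Jacobian          *)
(* criterion, so the characteristic plays no role.                            *)

(* With N = dim Rep, the three Ext dimensions come out as [N - \rank D1], [N - \rank D2],
   [N - \rank D2], where [D1] ([tangent_space_mx]) spans Rep_U + [gl, M] and [D2]
   ([orbit_tangent_mx]) spans [gl, M]. So the last two agree, and the first is at most the second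
   because [D2] lies in [D1]. The Ext groups rest on [ext1_dim_cocycles] (cocycles modulo
   coboundaries), [split_chain_projective] (flags are projective chains) and [ext1_dim_split]. The
   codimension bound is [codim_le_corank], which rests on [deformation_point],
   [deformation_leading], [leading_at0_inj] and [prime_chain_alg_indep]. *)
Require Import Defs.
From HB Require Import structures.
From mathcomp Require Import all_boot all_order all_algebra.
From mathcomp Require Import generic_quotient mpoly boolp.

Set Implicit Arguments.
Unset Strict Implicit.
Unset Printing Implicit Defensive.

Import GRing.Theory.
Local Open Scope ring_scope.
Local Open Scope quotient_scope.

(** * Algebraic independence and chains of primes *)

Lemma mmap_muni (R S : comNzRingType) (phi : {rmorphism R -> S}) m
    (s : 'I_m.+1 -> S) (G : {mpoly R[m.+1]}) :
  mmap phi s G =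
  (map_poly (mmap phi (s \o widen_ord (leqnSn m))) (muni G)).[s ord_max].
Proof.
rewrite muniE raddf_sum horner_sum; apply: eq_bigr => t _ /=.
rewrite map_polyZ hornerZ map_polyXn hornerXn /= mmapZ mmapX -mulrA.
congr (_ * _).
rewrite /mmap1 big_ord_recr /=; congr (_ * _).
by apply: eq_bigr => i _; rewrite mnmE.
Qed.

Lemma mmap_id (R : comNzRingType) n (G : {mpoly R[n]}) :
  mmap (@mpolyC n R) (fun i => 'X_i) G = G.
Proof.
rewrite [RHS]mpolyE; apply: eq_bigr => t _.
by rewrite mmap1_id mul_mpolyC.
Qed.

Lemma muni_eq0 (R : comNzRingType) m (G : {mpoly R[m.+1]}) :
  muni G = 0 -> G = 0.
Proof. by move=> G0; rewrite -[G]mmap_id mmap_muni G0 rmorph0 horner0. Qed.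

Definition alg_indep_mod (K : fieldType) (S : comNzRingType)
    (phi : {rmorphism K -> S}) (p : {pred S}) m (s : 'I_m -> S) : Prop :=
  forall G : {mpoly K[m]}, mmap phi s G \in p -> G = 0.

(** Read [G] as a polynomial in the last variable. Modulo [q] only its constant coefficient survives
    at [s], so that coefficient vanishes; the factor [s ord_max] that remains lies outside the prime
    [p] and cancels, which lowers the degree. *)
Lemma alg_indep_modS (K : fieldType) (S : comNzRingType)
    (phi : {rmorphism K -> S}) (p q : prime_idealr S) m (s : 'I_m.+1 -> S) :
  {subset p <= q} -> s ord_max \in q -> s ord_max \notin p ->
  alg_indep_mod phi q (s \o widen_ord (leqnSn m)) -> alg_indep_mod phi p s.
Proof.
move=> pq sq snp ind G; rewrite mmap_muni => Gp; apply: muni_eq0.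
set f := mmap phi _ in Gp ind.
elim/poly_ind: (muni G) Gp => // P c IH.
rewrite rmorphD rmorphM /= map_polyX map_polyC hornerD hornerMX hornerC => Gp.
have c0 : c = 0.
  apply: ind; have := pq _ Gp; rewrite rpredDl //.
  by apply: idealMr.
move: Gp; rewrite c0 raddf0 addr0 => Gp.
case/orP: (prime_idealr_closed_subproof _ _ Gp) => [/IH ->|].
  by rewrite mul0r add0r polyC0.
by rewrite (negPf snp).
Qed.

(** The count behind [mpoly_alg_dep]: (c D + 1)^N <= (c + 1)^N D^N, and this is below D^(N+1) once D
    exceeds (c + 1)^N. *)
Lemma exp_lt_exp N m c : (N < m)%N -> exists D, ((c * D).+1 ^ N < D ^ m)%N.
Proof.
move=> Nm; exists (c.+1 ^ N).+1; set D := (c.+1 ^ N).+1.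
have lt1 : ((c * D).+1 ^ N <= (c.+1 * D) ^ N)%N.
  case: N {Nm} @D => // N D.
  by rewrite leq_exp2r // mulSn addnC -addn1 leq_add2l.
apply: (leq_ltn_trans lt1); rewrite expnMn.
apply: (@leq_trans (D ^ N.+1)); last by rewrite leq_pexp2l.
by rewrite expnS ltn_pmul2r // expn_gt0.
Qed.

Lemma msizeM_leS (K : fieldType) N (p q : {mpoly K[N]}) a c :
  (msize p <= a.+1)%N -> (msize q <= c.+1)%N -> (msize (p * q) <= (a + c).+1)%N.
Proof.
have [->|p0] := eqVneq p 0; first by rewrite mul0r msize0.
have [->|q0] := eqVneq q 0; first by rewrite mulr0 msize0.
move=> pa qc; rewrite msizeM //; apply: (@leq_trans (a.+1 + c.+1).-1).
  by rewrite -!subn1 leq_sub2r // leq_add.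
by rewrite addnS addSn.
Qed.

(** Dimension count: the D^m monomials in the [s i] with exponents below D have degree below E = m b
    D + 1, so they involve at most E^N monomials in N variables, and E^N < D^m forces a linear
    relation. *)
Lemma mpoly_alg_dep (K : fieldType) N m (s : 'I_m -> {mpoly K[N]}) :
  (N < m)%N -> exists2 G : {mpoly K[m]}, G != 0 & mmap (@mpolyC N K) s G = 0.
Proof.
move=> Nm; pose b := \max_i msize (s i).
have [D ltD] := exp_lt_exp (m * b) Nm; set E := (_ * _).+1 in ltD.
pose mon (e : {ffun 'I_m -> 'I_D}) : 'X_{1..m} := [multinom val (e i) | i < m].
pose tar (e : {ffun 'I_N -> 'I_E}) : 'X_{1..N} := [multinom val (e i) | i < N].
(* Each row lists the coefficients of one monomial in the [s i]; a nonzero row of the left kernel is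
   the relation. *)
pose A := \matrix_(i < #|{ffun 'I_m -> 'I_D}|, j < #|{ffun 'I_N -> 'I_E}|)
  (mmap1 s (mon (enum_val i)))@_(tar (enum_val j)).
have ker0 : kermx A != 0.
  rewrite -mxrank_eq0 mxrank_ker -lt0n subn_gt0.
  by apply: (leq_ltn_trans (rank_leq_col A)); rewrite !card_ffun !card_ord.
have [i [nz]] : exists i, row i (kermx A) != 0 /\ row i (kermx A) *m A = 0.
  have /rowV0Pn [v vk v0] := ker0.
  case: (boolP [forall i, row i (kermx A) == 0]) => [/forallP all0|].
    case/negP: ker0; apply/eqP/row_matrixP => j; rewrite (eqP (all0 j)).
    by rewrite row0.
  rewrite negb_forall => /existsP[j nzj]; exists j; split => //.
  by rewrite -row_mul mulmx_ker row0.
set c := row i _ in nz *; move=> cA.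
pose G : {mpoly K[m]} := \sum_j c 0 j *: 'X_[mon (enum_val j)].
have mon_inj : injective mon.
  move=> e1 e2 /mnmP eq12; apply/ffunP => k; apply: val_inj.
  by have := eq12 k; rewrite !mnmE.
have Gcoef j : G@_(mon (enum_val j)) = c 0 j.
  rewrite raddf_sum (bigD1 j) //= mcoeffZ mcoeffX eqxx mulr1 big1 ?addr0 //.
  move=> k kj; rewrite mcoeffZ mcoeffX (inj_eq mon_inj) (inj_eq enum_val_inj).
  by rewrite (negPf kj) mulr0.
exists G.
  apply: contraNneq nz => G0; apply/eqP/rowP => j.
  by rewrite -Gcoef G0 mcoeff0 mxE.
have -> : mmap (@mpolyC N K) s G = \sum_j c 0 j *: mmap1 s (mon (enum_val j)).
  rewrite raddf_sum; apply: eq_bigr => j _.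
  by rewrite /= mmapZ mmapX mul_mpolyC.
have size_mon e : (msize (mmap1 s (mon e)) <= E)%N.
  apply: (@leq_trans (\sum_(i < m) mon e i * b).+1).
    rewrite /mmap1.
    elim/big_ind2: _ => [|p k q l|j _]; [by rewrite msize1|exact: msizeM_leS|].
    elim: (mon e j) => [|k IH]; first by rewrite expr0 msize1.
    rewrite exprS mulSn; apply: msizeM_leS => //.
    by apply: leqW; apply: (leq_bigmax j).
  rewrite ltnS -mulnA -[X in (_ <= X * _)%N]card_ord -sum_nat_const.
  apply: leq_sum => j _.
  by rewrite mnmE mulnC leq_mul2l (ltnW (ltn_ord _)) orbT.
apply/mpolyP => t; rewrite mcoeff0.
(* In degree at least [E] every coefficient vanishes by [size_mon]; below, all exponents are smaller
   than [E], so [t] indexes a column of [A]. *)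
case: (leqP E (mdeg t)) => [big|small].
  rewrite raddf_sum big1 //= => j _; rewrite mcoeffZ.
  rewrite (_ : _@_t = 0) ?mulr0 //; apply: memN_msupp_eq0.
  by apply: msize_mdeg_ge; apply: leq_trans big.
have ltt k : (t k < E)%N.
  by apply: leq_ltn_trans small; rewrite mdegE (bigD1 k) //= leq_addr.
pose e := [ffun k => Ordinal (ltt k)] : {ffun 'I_N -> 'I_E}.
have -> : t = tar e by apply/mnmP => k; rewrite mnmE ffunE.
have := congr1 (fun M : 'rV_ _ => M 0 (enum_rank e)) cA.
rewrite !mxE => <-; rewrite raddf_sum; apply: eq_bigr => j _ /=.
by rewrite /= mcoeffZ; congr (_ * _); rewrite mxE enum_rankK.
Qed.

Lemma alg_indep_mod_snoc (K : fieldType) (S : comNzRingType)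
    (phi : {rmorphism K -> S}) (p q : prime_idealr S) m (s : 'I_m -> S) x :
  {subset p <= q} -> x \in q -> x \notin p -> alg_indep_mod phi q s ->
  exists s' : 'I_m.+1 -> S, alg_indep_mod phi p s'.
Proof.
(* [insub] succeeds on the indices below [m], where [s] is used, and fails on the last one, which
   gets the default [x]. *)
move=> pq xq xp ind; exists (fun i => oapp s x (insub (val i))).
have max0 : insub m = None :> option 'I_m by rewrite insubF ?ltnn.
apply: alg_indep_modS pq _ _ _; rewrite /= ?max0 //.
rewrite [X in alg_indep_mod _ _ X](_ : _ = s) //; apply/funext => i /=.
by have /= -> := valK i.
Qed.

(** Going down the chain, each strict inclusion contributes an element of the larger prime outside
    the smaller one. At the bottom, n + r elements are independent modulo a prime, hence
    algebraically independent in a polynomial ring in N variables. *)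
Lemma prime_chain_alg_indep (K : fieldType) N (P : prime_idealr {mpoly K[N]})
    r (s : 'I_r -> {mpoly K[N]}) n :
  alg_indep_mod (@mpolyC N K) P s -> prime_chain P n -> (n + r <= N)%N.
Proof.
move=> ind [p [pn step]].
have chain k : (k <= n)%N -> exists s' : 'I_(k + r) -> {mpoly K[N]},
    alg_indep_mod (@mpolyC N K) (p (n - k)%N) s'.
  elim: k => [_|k IH kn]; first by exists s => G; rewrite subn0 pn => /ind.
  have [s' ind'] := IH (ltnW kn).
  have [] := step (n - k.+1)%N; first by rewrite ltn_subrL (leq_trans _ kn).
  rewrite -subSn // subSS => pq [x xq xp].
  exact: alg_indep_mod_snoc pq xq xp ind'.
have [s' ind'] := chain n (leqnn n); rewrite leqNgt; apply/negP => lt.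
have [G /eqP G0 sG] := mpoly_alg_dep s' lt.
by apply: G0; apply: ind'; rewrite sG rpred0.
Qed.

(** The bound on chains ending at [P] makes the codimension of [P] an attained maximum; the
    codimension of [I] is then the minimum of a nonempty set of naturals. *)
Lemma is_codim_exists (S : comNzRingType) (I : S -> Prop) (P : prime_idealr S)
    e : (forall s, I s -> s \in P) ->
  (forall n, prime_chain P n -> (n <= e)%N) ->
  exists2 c, is_codim I c & (c <= e)%N.
Proof.
move=> IP Pe.
have [c0 c0P] : exists c0, prime_codim P c0.
  have ex0 : exists n, `[< prime_chain P n >].
    by exists 0; apply/asboolP; exists (fun=> P).
  have bnd n : `[< prime_chain P n >] -> (n <= e)%N by move/asboolP/Pe.
  case: (ex_maxnP ex0 bnd) => c /asboolP cP cmax; exists c; split=> // n nP.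
  by apply: cmax; apply/asboolP.
pose good c := exists2 P' : prime_idealr S,
  (forall s, I s -> s \in P') & prime_codim P' c.
have ex0 : exists c, `[< good c >] by exists c0; apply/asboolP; exists P.
case: (ex_minnP ex0) => c /asboolP cP cmin; exists c.
  by split=> // P' c' IP' cP'; apply: cmin; apply/asboolP; exists P'.
apply: leq_trans (Pe _ c0P.1).
by apply: cmin; apply/asboolP; exists P.
Qed.

(** * Leading terms at s = 0 *)

Lemma rmorph_mmap (R S T : comNzRingType) n (phi : {rmorphism R -> S})
    (chi : {rmorphism R -> T}) (psi : {rmorphism S -> T}) (h : 'I_n -> S) G :
  psi \o phi =1 chi -> psi (mmap phi h G) = mmap chi (psi \o h) G.
Proof.
move=> eq_chi; rewrite rmorph_sum; apply: eq_bigr => t _.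
rewrite rmorphM -eq_chi rmorph_prod; congr (_ * _).
by apply: eq_bigr => i _; rewrite rmorphXn.
Qed.

Section LocalExpansion.
Variables (F : fieldType) (r : nat).
Let A : comNzRingType := {mpoly F[r]}.
(** The field F(t_1, ..., t_r)(s): the t_i are the variables of the inner polynomial ring, s is the
    outer ['X]. *)
Let L : fieldType := {fraction {poly {mpoly F[r]}}}.
Definition const_frac : {rmorphism F -> L} :=
  [the {rmorphism F -> L} of
    (@tofrac _ : {poly {mpoly F[r]}} -> L) \o (polyC \o @mpolyC r F)].

(* x = s^k (a + O(s)) in the local ring at s = 0, with denominator u.         *)
Definition leading_at0 k (x : L) (a : {mpoly F[r]}) : Prop :=
  exists u q : {poly {mpoly F[r]}},
    [/\ u.[0] = 1, q.[0] = a & x * tofrac u = tofrac ('X^k * q)].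

Lemma leading_at0M k l x y a b :
  leading_at0 k x a -> leading_at0 l y b -> leading_at0 (k + l) (x * y) (a * b).
Proof.
move=> [u [q [u1 qa xE]]] [v [p [v1 pb yE]]]; exists (u * v), (q * p).
rewrite !hornerM u1 v1 qa pb mulr1; split=> //.
by rewrite tofracM mulrACA xE yE -tofracM exprD mulrACA.
Qed.

Lemma leading_at0D k x y a b :
  leading_at0 k x a -> leading_at0 k y b -> leading_at0 k (x + y) (a + b).
Proof.
move=> [u [q [u1 qa xE]]] [v [p [v1 pb yE]]].
exists (u * v), (q * v + p * u).
rewrite hornerD !hornerM u1 v1 qa pb !mulr1; split=> //.
rewrite tofracM mulrDl mulrA xE [tofrac u * _]mulrC mulrA yE.
by rewrite -!tofracM -tofracD -!mulrA -mulrDr.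
Qed.

(** Allows terms of higher order in s to be added at order k, where they contribute 0. *)
Lemma leading_at0_lt k l x a :
  (k < l)%N -> leading_at0 l x a -> leading_at0 k x 0.
Proof.
move=> kl [u [q [u1 qa xE]]]; exists u, ('X^(l - k) * q).
rewrite hornerM hornerXn expr0n subn_eq0 leqNgt kl mul0r; split=> //.
by rewrite xE mulrA -exprD subnKC // ltnW.
Qed.

Lemma leading_at0_0 k a : leading_at0 k 0 a -> a = 0.
Proof.
move=> [u [q [_ <- /esym/eqP]]]; rewrite mul0r tofrac_eq0 mulf_eq0.
by rewrite expf_eq0 polyX_eq0 andbF => /eqP ->; rewrite horner0.
Qed.

Lemma leading_at0C c : leading_at0 0 (const_frac c) c%:MP.
Proof.
by exists 1, (c%:MP)%:P; rewrite hornerC hornerC expr0 mul1r tofrac1 mulr1.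
Qed.

Lemma leading_at0_1 : leading_at0 0 1 1.
Proof. by have := leading_at0C 1; rewrite rmorph1. Qed.

Lemma leading_at0_monom (h : 'I_r -> L) (t : 'X_{1..r}) :
  (forall i, leading_at0 1 (h i) 'X_i) ->
  leading_at0 (mdeg t) (mmap1 h t) 'X_[t].
Proof.
move=> lead; rewrite mpolyXE_id mdegE /mmap1.
elim: (index_enum _) => [|i s IH].
  by rewrite !big_nil; exact: leading_at0_1.
rewrite !big_cons; apply: leading_at0M => //.
elim: (t i) => [|k IHk]; first by rewrite !expr0; exact: leading_at0_1.
by rewrite !exprS -add1n; apply: leading_at0M.
Qed.

(** Here h_i = s t_i + O(s^2). If k is the lowest degree occurring in [G], the coefficient of s^k in
    G(h) is the homogeneous part of [G] of degree k in the t_i, which is nonzero. *)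
Lemma leading_at0_inj (h : 'I_r -> L) (G : {mpoly F[r]}) :
  (forall i, leading_at0 1 (h i) 'X_i) -> mmap const_frac h G = 0 -> G = 0.
Proof.
move=> lead G0; apply/eqP/contraT => nzG.
have ex : exists k, has (fun t => mdeg t == k) (msupp G).
  move: nzG; rewrite -msupp_eq0; case: (msupp G) => // t s _.
  by exists (mdeg t); rewrite /= eqxx.
case: (ex_minnP ex) => k /hasP[t tG /eqP tk] kmin.
pose lt (t : 'X_{1..r}) : {mpoly F[r]} :=
  if mdeg t == k then G@_t *: 'X_[t] else 0.
have : leading_at0 k (mmap const_frac h G) (\sum_(t <- msupp G) lt t).
  rewrite /mmap big_seq_cond [X in leading_at0 _ _ X]big_seq_cond.
  elim/big_ind2: _ => [|x a y b|t' /andP[t'G _]]; last 1 first.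
  - have lead_t : leading_at0 (mdeg t') (const_frac G@_t' * mmap1 h t')
        (G@_t' *: 'X_[t']).
      rewrite -mul_mpolyC -[mdeg t']add0n.
      by apply: leading_at0M; [exact: leading_at0C|exact: leading_at0_monom].
    rewrite /lt; have [<- //|neq] := eqVneq; apply: leading_at0_lt lead_t.
    rewrite ltn_neqAle eq_sym neq; apply: kmin.
    by apply/hasP; exists t'.
  - by exists 1, 0; rewrite hornerC horner0 mul0r mulr0 tofrac0.
  - exact: leading_at0D.
rewrite G0 => /leading_at0_0/(congr1 (mcoeff t)).
rewrite mcoeff0 raddf_sum (bigD1_seq t) ?msupp_uniq //= /lt tk eqxx.
rewrite mcoeffZ mcoeffX eqxx mulr1 big1 ?addr0 => [/eqP|t' t't].
  by rewrite mcoeff_eq0 tG.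
by case: ifP; rewrite ?mcoeff0 // mcoeffZ mcoeffX (negPf t't) mulr0.
Qed.

(** Translating the variables by constants is an automorphism of the polynomial ring ([trK]), and
    [G] at h is [tr 1 G] at h - c. *)
Lemma alg_indep_translate (h : 'I_r -> L) (c : 'I_r -> F) (G : {mpoly F[r]}) :
  (forall i, leading_at0 1 (h i - const_frac (c i)) 'X_i) ->
  mmap const_frac h G = 0 -> G = 0.
Proof.
move=> lead G0.
pose tr e : {mpoly F[r]} -> {mpoly F[r]} :=
  mmap (@mpolyC r F) (fun i => 'X_i + (e * c i)%:MP).
have trK : tr (-1) (tr 1 G) = G.
  rewrite /tr (@rmorph_mmap _ _ _ _ _ (@mpolyC r F)); last first.
    by move=> x /=; rewrite mmapC.
  rewrite -[RHS]mmap_id; congr mmap; apply/funext => i /=.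
  rewrite mmapD mmapC mmapX mmap1U mulN1r mul1r mpolyCN.
  by rewrite -addrA addNr addr0.
rewrite -trK; suff -> : tr 1 G = 0 by rewrite /tr mmap0.
apply: leading_at0_inj lead _; rewrite -[RHS]G0.
rewrite /tr (@rmorph_mmap _ _ _ _ _ const_frac); last first.
  by move=> x /=; rewrite mmapC.
congr mmap; apply/funext => i /=.
by rewrite mmapD mmapC mmapX mmap1U mul1r subrK.
Qed.

End LocalExpansion.

(** * Deformations of a flagged representation *)

Section RowSpace.
Variables (F : fieldType) (m n : nat) (A : 'M[F]_(m, n)).

Definition row_space : {pred 'rV[F]_n} := fun u => (u <= A)%MS.
Fact row_space_submod_closed : submod_closed row_space.
Proof.
split=> [|a u v uA vA]; first exact: sub0mx.
by rewrite unfold_in addmx_sub // scalemx_sub.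
Qed.
HB.instance Definition _ :=
  GRing.isSubmodClosed.Build F 'rV[F]_n row_space row_space_submod_closed.

End RowSpace.

Lemma row_space_summand (F : fieldType) m n (A : 'M[F]_(m, n)) :
  direct_summand (row_space A).
Proof.
exists (row_space A^C%MS : submodClosed _); split=> [x|x xA xC].
  have : (x <= A + A^C)%MS.
    by apply: submx_full; apply: addsmx_compl_full.
  case/sub_addsmxP=> -[c e] /= ->; exists (c *m A), (e *m A^C%MS).
  by split=> //; rewrite unfold_in submxMl.
have : (x <= A :&: A^C)%MS by rewrite sub_capmx; apply/andP; split.
by rewrite capmx_compl submx0 => /eqP.
Qed.

Lemma row_space_rank (F : fieldType) m n (A : 'M[F]_(m, n)) :
  row_free A -> has_rank (row_space A) m.
Proof.
move=> freeA k phi; exists A; split=> [i||u].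
- by rewrite unfold_in row_sub.
- by rewrite /row_free mxrank_map.
- by rewrite unfold_in map_submx.
Qed.

(** The identity of F is one of the field-valued points tested by [has_rank]; there the matrix is a
    basis of U itself. *)
Lemma has_rank_basis (F : fieldType) n (U : submodClosed 'rV[F]_n) r :
  has_rank U r -> exists B : 'M[F]_(r, n),
    row_free B /\ forall u, (u \in U) = (u <= B)%MS.
Proof.
move=> /(_ F idfun) [B [BU freeB UB]]; exists B.
rewrite map_mx_id in freeB; split=> // u; apply/idP/idP.
  by move=> /UB; rewrite !map_mx_id.
case/submxP=> c ->; rewrite mulmx_sum_row rpred_sum // => i _.
by rewrite rpredZ.
Qed.

Lemma repfl_of_bases (L : fieldType) (Q : quiver) (nu : nat)
    (d : filtration Q nu) (M : rep_pt L (d ord_max))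
    (B : forall k i, 'M[L]_(d k i, d ord_max i)) :
  (forall k i, row_free (B k i)) ->
  (forall (k : 'I_nu) i, (B (step_src k) i <= B (step_tgt k) i)%MS) ->
  (forall k a, (B k (src a) *m M a <= B k (tgt a))%MS) ->
  exists y : repfl L d, rf_rep y = M.
Proof.
move=> freeB inclB stabB.
have incl (k : 'I_nu) i :
    {subset row_space (B (step_src k) i) <= row_space (B (step_tgt k) i)}.
  by move=> u uB; apply: submx_trans (inclB k i).
have stab k (a : arr Q) (u : 'rV[L]_(d ord_max (src a))) :
    u \in (row_space (B k (src a)) : submodClosed _) ->
    u *m M a \in (row_space (B k (tgt a)) : submodClosed _).
  by move=> uB; apply: submx_trans (stabB k a); apply: submxMr.
by exists (@RepFl L Q nu d M (fun k i => row_space (B k i))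
  (fun k i => row_space_summand _) (fun k i => row_space_rank (freeB k i))
  incl stab).
Qed.

Section RepVector.
Variables (R : nzRingType) (Q : quiver) (n : vert Q -> nat).

Definition rep_index (a : arr Q) (i : 'I_(n (src a))) (j : 'I_(n (tgt a))) :
    'I_#|rep_coord n| :=
  enum_rank (Tagged (fun a : arr Q => ('I_(n (src a)) * 'I_(n (tgt a)))%type)
    (i, j)).

Definition rep_of_row (v : 'rV[R]_#|rep_coord n|) : rep_pt R n :=
  fun a => \matrix_(i, j) v 0 (rep_index i j).

Definition row_of_rep (M : rep_pt R n) : 'rV[R]_#|rep_coord n| :=
  \row_t let c := enum_val t in M (tag c) (tagged c).1 (tagged c).2.

Lemma row_of_repK M a : rep_of_row (row_of_rep M) a = M a.
Proof. by apply/matrixP => i j; rewrite !mxE enum_rankK. Qed.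

Lemma rep_of_row_is_linear a : linear (fun v => rep_of_row v a).
Proof. by move=> c u v; apply/matrixP => i j; rewrite !mxE. Qed.

End RepVector.

Section Deformation.
Variables (F : fieldType) (Q : quiver) (nu : nat) (d : filtration Q nu).
Variables (x : repfl F d) (r : nat).
Let n := d ord_max.
Let M := rf_rep x.
Variables (T : 'I_r -> rep_pt F n) (X : 'I_r -> forall i, 'M[F]_(n i)).
Hypothesis T_stable : forall l k a (u : 'rV[F]_(n (src a))),
  u \in rf_flag x k (src a) -> u *m T l a \in rf_flag x k (tgt a).

Let Rp : comNzRingType := {poly {mpoly F[r]}}.
Let L : fieldType := {fraction {poly {mpoly F[r]}}}.
Let kappa : {rmorphism F -> Rp} :=
  [the {rmorphism F -> Rp} of polyC \o @mpolyC r F].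
Let frac : {rmorphism Rp -> L} := [the {rmorphism Rp -> L} of @tofrac _].
Let tau (l : 'I_r) : Rp := ('X_l)%:P.

Let Tt a : 'M[Rp]_(n (src a), n (tgt a)) :=
  \sum_l tau l *: map_mx kappa (T l a).
Let Xt i : 'M[Rp]_(n i) := \sum_l tau l *: map_mx kappa (X l i).
Let Mt a : 'M[Rp]_(n (src a), n (tgt a)) := map_mx kappa (M a).
(** [ML] below is N = M + s sum t_l T_l after the base change g = 1 + s sum t_l X_l; since vectors
    are rows, it reads g^-1 N g. *)
Let g i : 'M[Rp]_(n i) := 1%:M + 'X *: Xt i.
Let N a := Mt a + 'X *: Tt a.
Let Ct a := Tt a + Mt a *m Xt (tgt a) - Xt (src a) *m Mt a
  + 'X *: (Tt a *m Xt (tgt a)).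
Let gL i := map_mx frac (g i).
Let ML a := invmx (gL (src a)) *m map_mx frac (N a) *m gL (tgt a).

Let commutator a : N a *m g (tgt a) - g (src a) *m Mt a = 'X *: Ct a.
Proof.
rewrite /N /g /Ct mulmxDr mulmx1 mulmxDl [(1%:M + _) *m _]mulmxDl mul1mx.
rewrite -!scalemxAl -!scalemxAr scalerDr scalerBr scalerDr opprD addrA.
rewrite -(addrA (Mt a)) (addrC (Mt a)) addrK addrA; exact: addrAC.
Qed.

Let ev : {rmorphism Rp -> {mpoly F[r]}} :=
  [the {rmorphism Rp -> {mpoly F[r]}} of horner_eval (0 : {mpoly F[r]})].

Let ev_kappa m p (S : 'M[F]_(m, p)) :
  map_mx ev (map_mx kappa S) = map_mx (@mpolyC r F) S.
Proof. by apply/matrixP => i j; rewrite !mxE /= /horner_eval hornerC. Qed.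

Let ev_sum m p (S : 'I_r -> 'M[F]_(m, p)) :
  map_mx ev (\sum_l tau l *: map_mx kappa (S l)) =
  \sum_l 'X_l *: map_mx (@mpolyC r F) (S l).
Proof.
rewrite raddf_sum; apply: eq_bigr => l _; apply/matrixP => i j.
by rewrite !mxE /= /horner_eval hornerM !hornerC.
Qed.

Let evX : ev 'X = 0.
Proof. by rewrite /= /horner_eval hornerX. Qed.

Let ev_g i : map_mx ev (g i) = 1%:M.
Proof. by rewrite map_mxD map_mx1 map_mxZ evX scale0r addr0. Qed.

Let ev_det i : (\det (g i)).[0] = 1.
Proof. by rewrite -[LHS]/(ev _) -det_map_mx ev_g det1. Qed.

Let gL_unit i : gL i \in unitmx.
Proof.
rewrite unitmxE unitfE det_map_mx tofrac_eq0; apply: contra_eq_neq (ev_det i).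
by move=> ->; rewrite horner0 eq_sym oner_neq0.
Qed.

(** By [commutator], ML - M = g^-1 (N g - g M) = s g^-1 Ct. Writing g^-1 = adj g / det g, the
    denominator det g is 1 at s = 0, where adj g is the identity and [Ct] reduces to its first-order
    part. *)
Lemma deformation_leading a i j :
  leading_at0 1 (ML a i j - const_frac F r (M a i j))
    (\sum_l (T l a + M a *m X l (tgt a) - X l (src a) *m M a) i j *: 'X_l).
Proof.
pose q := \adj (g (src a)) *m Ct a.
exists (\det (g (src a))), (q i j); split; first exact: ev_det.
  have -> : (q i j).[0] = (map_mx ev q) i j by rewrite [RHS]mxE.
  rewrite map_mxM map_mx_adj ev_g adj1 mul1mx.
  have evC : map_mx ev (Ct a) = \sum_l 'X_l *: map_mx (@mpolyC r F)
      (T l a + M a *m X l (tgt a) - X l (src a) *m M a).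
    rewrite /Ct map_mxD map_mxZ evX scale0r addr0.
    rewrite map_mxB map_mxD !map_mxM !ev_sum !ev_kappa mulmx_sumr mulmx_suml.
    rewrite -big_split -sumrB; apply: eq_bigr => l _.
    rewrite map_mxB map_mxD !map_mxM scalerBr scalerDr.
    by rewrite scalemxAr scalemxAl.
  rewrite evC summxE; apply: eq_bigr => l _.
  by rewrite mxE mxE mulrC mul_mpolyC.
have qE : 'X *: q = \adj (g (src a)) *m ('X *: Ct a) by rewrite scalemxAr.
have -> : 'X^1 * q i j = ('X *: q) i j by rewrite expr1 [RHS]mxE.
rewrite qE -commutator.
have -> : ML a i j - const_frac F r (M a i j) = (ML a - map_mx frac (Mt a)) i j.
  by rewrite [RHS]mxE; congr (_ + _); rewrite !mxE.
rewrite mulrC -[RHS]/(frac _).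
set A := \adj (g (src a)) *m _.
have -> : frac (A i j) = (map_mx frac A) i j by rewrite [RHS]mxE.
rewrite /A.
rewrite map_mxM map_mx_adj map_mxB !map_mxM /=.
rewrite -[map_mx frac (g (src a))]/(gL _) -[map_mx frac (g (tgt a))]/(gL _).
have -> : map_mx frac (N a) *m gL (tgt a) = gL (src a) *m ML a.
  by rewrite /ML -mulmxA mulKVmx.
by rewrite -mulmxBr mulmxA mul_adj_mx mul_scalar_mx det_map_mx [RHS]mxE.
Qed.

(** M and all T_l stabilise the flag of [x], hence so does N after extension of scalars to [L]; the
    base change g moves both N and the flag. *)
Lemma deformation_point : exists y : repfl L d, rf_rep y = ML.
Proof.
have /fin_all_exists [B0 B0P] : forall k,
    exists B : forall i, 'M[F]_(d k i, n i),
    forall i, row_free (B i) /\ forall u, (u \in rf_flag x k i) = (u <= B i)%MS.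
  move=> k; have h i : exists B : 'M[F]_(d k i, n i),
      row_free B /\ forall u, (u \in rf_flag x k i) = (u <= B)%MS.
    by apply: has_rank_basis => *; exact: rf_rank.
  by have /fin_all_exists [Bk BkP] := h; exists Bk.
pose iL : {rmorphism F -> L} := [the {rmorphism F -> L} of frac \o kappa].
pose B k i := map_mx iL (B0 k i) *m gL i.
apply: (@repfl_of_bases L Q nu d ML B) => [k i|k i|k a].
- rewrite /row_free mxrankMfree ?row_free_unit //.
  by rewrite mxrank_map; have [] := B0P k i.
- apply: submxMr; rewrite map_submx; apply/row_subP => j.
  rewrite -(B0P _ _).2; apply: rf_incl; rewrite (B0P _ _).2; exact: row_sub.
rewrite /B /ML -!mulmxA mulKVmx // !mulmxA; apply: submxMr.
have stab (S : rep_pt F n) : (forall u : 'rV_(n (src a)),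
    u \in rf_flag x k (src a) -> u *m S a \in rf_flag x k (tgt a)) ->
    (map_mx iL (B0 k (src a)) *m map_mx iL (S a)
       <= map_mx iL (B0 k (tgt a)))%MS.
  move=> Sstab; rewrite -map_mxM map_submx; apply/row_subP => j.
  rewrite row_mul -(B0P _ _).2; apply: Sstab.
  by rewrite (B0P _ _).2; exact: row_sub.
rewrite map_mxD mulmxDr addmx_sub //.
  rewrite -map_mx_comp; apply: stab; exact: rf_stable.
rewrite map_mxZ -scalemxAr scalemx_sub // raddf_sum mulmx_sumr.
rewrite summx_sub // => l _.
rewrite /= map_mxZ -scalemxAr scalemx_sub // -map_mx_comp; apply: stab.
exact: T_stable.
Qed.

End Deformation.

(** * The codimension bound *)

Section KernelPrime.
Variables (S : comNzRingType) (L : fieldType) (psi : {rmorphism S -> L}).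

Definition kernel_prime : {pred S} := fun f => psi f == 0.
Fact kernel_prime_idealr : idealr_closed kernel_prime.
Proof.
split=> [||a f g];
  rewrite ?unfold_in /kernel_prime ?rmorph0 ?rmorph1 ?oner_eq0 //.
by move=> /eqP f0 /eqP g0; rewrite rmorphD rmorphM f0 g0 mulr0 addr0.
Qed.
Fact kernel_prime_prime : prime_idealr_closed kernel_prime.
Proof. by move=> f g; rewrite !unfold_in /kernel_prime rmorphM mulf_eq0. Qed.
HB.instance Definition _ := isIdealr.Build S kernel_prime kernel_prime_idealr.
HB.instance Definition _ :=
  isPrimeIdealrClosed.Build S kernel_prime kernel_prime_prime.

End KernelPrime.

(** Invert a maximal minor of a basis of the row space. The delta condition makes the leading term
    of the deformation at coordinate [f l] the single variable t_l. *)
Lemma dual_row_basis (F : fieldType) m n (D : 'M[F]_(m, n)) :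
  exists (B : 'M[F]_(\rank D, n)) (f : 'I_(\rank D) -> 'I_n),
    (B <= D)%MS /\ forall l k, B l (f k) = (l == k)%:R.
Proof.
have full : row_full (row_base D)^T by rewrite /row_full mxrank_tr eq_row_base.
pose f := fullrankfun full.
pose C := rowsub f (row_base D)^T.
have uC : C^T \in unitmx by rewrite unitmx_tr fullrowsub_unit.
exists (invmx C^T *m row_base D), f; split.
  by rewrite (submx_trans (submxMl _ _)) // eq_row_base.
move=> l k; have := congr1 (fun A : 'M_ _ => A l k) (mulVmx uC).
rewrite [RHS]mxE => <-; rewrite !mxE; apply: eq_bigr => t _.
by rewrite !mxE.
Qed.

Lemma map_mpoly_mmap (K F L : comNzRingType) (iota : {rmorphism K -> F})
    (phi : {rmorphism F -> L}) (chi : {rmorphism K -> L}) n (h : 'I_n -> L)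
    (G : {mpoly K[n]}) :
  phi \o iota =1 chi -> mmap phi h (map_mpoly iota G) = mmap chi h G.
Proof.
move=> eq_chi; rewrite /map_mpoly.
rewrite (@rmorph_mmap _ _ _ _ [the {rmorphism K -> _} of @mpolyC n F \o iota]
  chi); last by move=> c /=; rewrite mmapC -eq_chi.
by congr mmap; apply/funext => i /=; rewrite mmapX mmap1U.
Qed.

(** Evaluation at the deformed representation has a prime kernel above the image ideal. The
    coordinates [f l] of this representation are those of M plus s t_l + O(s^2), so [\rank D]
    coordinate functions are independent modulo that prime. *)
Lemma codim_le_corank (K : fieldType) (Q : quiver) (nu : nat)
    (d : filtration Q nu) (F : fieldType) (iota : {rmorphism K -> F})
    (x : repfl F d) (D : 'M[F]_#|rep_coord (d ord_max)|) :
  (forall v, (v <= D)%MS -> exists X : forall i, 'M[F]_(d ord_max i),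
     forall k a (u : 'rV_(d ord_max (src a))), u \in rf_flag x k (src a) ->
       u *m (rep_of_row v a -
         (rf_rep x a *m X (tgt a) - X (src a) *m rf_rep x a))
         \in rf_flag x k (tgt a)) ->
  exists2 c, is_codim (image_ideal K d) c &
    (c <= #|rep_coord (d ord_max)| - \rank D)%N.
Proof.
move=> tangent; have [B [f [BD Bf]]] := dual_row_basis D.
(* Each basis vector B_l is T_l + M X_l - X_l M with T_l stabilising the flag, so the first-order
   term of the deformation is sum t_l B_l. *)
have tg l := tangent (row l B) (submx_trans (row_sub l B) BD).
have /fin_all_exists [X Xstab] := tg.
have [y yE] := deformation_point X Xstab.
pose L : fieldType := {fraction {poly {mpoly F[\rank D]}}}.
pose phi : {rmorphism K -> L} :=
  [the {rmorphism K -> L} of const_frac F (\rank D) \o iota].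
pose h t := row_of_rep (rf_rep y) 0 t.
pose psi : {rmorphism {mpoly K[#|rep_coord (d ord_max)|]} -> L} :=
  [the {rmorphism _ -> _} of mmap phi h].
have psiE g : psi g = rep_eval phi (rf_rep y) g.
  by rewrite /psi /= /rep_eval; congr mmap; apply/funext => t; rewrite /h mxE.
apply: (@is_codim_exists _ _ (kernel_prime psi)).
  by move=> g /(_ L phi y) g0; rewrite unfold_in /kernel_prime psiE g0.
move=> n chain; rewrite -(leq_add2r (\rank D)) subnK; last exact: rank_leq_row.
apply: (@prime_chain_alg_indep _ _ (kernel_prime psi) _
  (fun l => 'X_(f l))) => //.
move=> G; rewrite unfold_in /kernel_prime => /eqP.
rewrite (@rmorph_mmap _ _ _ _ _ phi); last by move=> c /=; rewrite mmapC.
(* The coefficients are extended to F because the constants subtracted next, the coordinates of M,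
   lie in F. *)
rewrite -(@map_mpoly_mmap _ _ _ iota (const_frac F (\rank D))) // => G0.
have : map_mpoly iota G = 0.
  apply: (@alg_indep_translate _ _ _
    (fun l => row_of_rep (rf_rep x) 0 (f l)) _ _ G0) => l /=.
  rewrite mmapX mmap1U /h !mxE yE.
  set c := enum_val (f l).
  set S := fun l a => rep_of_row (row l B) a -
     (rf_rep x a *m X l (tgt a) - X l (src a) *m rf_rep x a).
  have <- : \sum_k (S k (tag c) + rf_rep x (tag c) *m X k (tgt (tag c))
      - X k (src (tag c)) *m rf_rep x (tag c)) (tagged c).1 (tagged c).2
      *: 'X_k = 'X_l :> {mpoly F[\rank D]}.
    have SE k : (S k (tag c) + rf_rep x (tag c) *m X k (tgt (tag c))
        - X k (src (tag c)) *m rf_rep x (tag c)) (tagged c).1 (tagged c).2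
        = (k == l)%:R.
      rewrite -addrA subrK mxE mxE /rep_index -Bf; congr (fun_of_matrix B _ _).
      rewrite -[RHS]enum_valK -/c; congr enum_rank.
      by case: (c) => a [].
    rewrite (bigD1 l) //= SE eqxx scale1r big1 ?addr0 // => k kl.
    by rewrite SE (negPf kl) scale0r.
  exact: deformation_leading.
move=> mG0; apply/mpolyP => t; rewrite mcoeff0.
have := congr1 (mcoeff t) mG0; rewrite mcoeff_map_mpoly mcoeff0 => /eqP.
by rewrite fmorph_eq0 => /eqP.
Qed.

(** * Free representations *)

Section FreeRepresentation.
Variables (F : fieldType) (Q : quiver) (V : vert Q -> lmodType F).

(** Formal expressions for elements of the free representation on V; [FLin] stands for c t + u and
    so covers both addition and scaling. *)
Inductive free_term : vert Q -> Type :=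
| FGen i (v : V i) : free_term i
| FAct a (t : free_term (src a)) : free_term (tgt a)
| FLin i (c : F) (t u : free_term i) : free_term i.

Fixpoint term_eval (Y : qrep F Q) (phi : forall i, {linear V i -> Y i}) i
    (t : free_term i) : Y i :=
  match t with
  | FGen i v => phi i v
  | FAct a t => qmor Y a (term_eval phi t)
  | FLin i c t u => c *: term_eval phi t + term_eval phi u
  end.

(* Identifying terms with equal values in every representation makes the      *)
(* module axioms and the universal property hold by construction.  The        *)
(* quantification over Y is in Prop, so free_sp stays in the universe of V.   *)
Definition term_equiv i (t u : {classic free_term i}) : bool :=
  `[< forall (Y : qrep F Q) (phi : forall i, {linear V i -> Y i}),
        term_eval phi t = term_eval phi u >].

Lemma term_equiv_refl i : reflexive (@term_equiv i).
Proof. by move=> t; apply/asboolP. Qed.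
Lemma term_equiv_sym i : ssrbool.symmetric (@term_equiv i).
Proof. by move=> t u; apply/asboolP/asboolP => + Y phi => /(_ Y phi) ->. Qed.
Lemma term_equiv_trans i : transitive (@term_equiv i).
Proof.
move=> t u v /asboolP ut /asboolP tv; apply/asboolP => Y phi.
by rewrite ut tv.
Qed.
Canonical term_equivRel i := EquivRel (@term_equiv i)
  (@term_equiv_refl i) (@term_equiv_sym i) (@term_equiv_trans i).

Definition free_sp i := {eq_quot term_equivRel i}.
HB.instance Definition _ i := Choice.on (free_sp i).

Definition free_class i (t : free_term i) : free_sp i :=
  \pi_({eq_quot term_equivRel i}) (t : {classic free_term i}).
Definition free_repr i (z : free_sp i) : free_term i :=
  repr (z : {eq_quot term_equivRel i}).

Definition free_eval (Y : qrep F Q) (phi : forall i, {linear V i -> Y i}) i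
  (z : free_sp i) : Y i := term_eval phi (free_repr z).

Lemma free_reprK i (z : free_sp i) : free_class (free_repr z) = z.
Proof. exact: reprK. Qed.

Lemma free_evalE Y phi i (t : free_term i) :
  @free_eval Y phi i (free_class t) = term_eval phi t.
Proof.
have /eqmodP/asboolP := free_reprK (free_class t); exact.
Qed.

Lemma free_eval_inj i (y z : free_sp i) :
  (forall Y phi, @free_eval Y phi i y = free_eval phi z) -> y = z.
Proof.
move=> yz; rewrite -[y]free_reprK -[z]free_reprK.
by apply/eqmodP/asboolP => Y phi; apply: yz.
Qed.

Definition free_lin i c (y z : free_sp i) : free_sp i :=
  free_class (FLin c (free_repr y) (free_repr z)).
Definition free_zero i : free_sp i := free_class (FGen 0).

Lemma free_eval_lin Y phi i c y z :
  @free_eval Y phi i (free_lin c y z) = c *: free_eval phi y + free_eval phi z.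
Proof. exact: free_evalE. Qed.
Lemma free_eval_zero Y phi i : @free_eval Y phi i (free_zero i) = 0.
Proof. by rewrite free_evalE /= linear0. Qed.

Definition free_add i (y z : free_sp i) := free_lin 1 y z.
Definition free_opp i (y : free_sp i) := free_lin (-1) y (free_zero i).
Definition free_scale i c (y : free_sp i) := free_lin c y (free_zero i).
Let evalE := (free_eval_lin, free_eval_zero, scale1r, scaleN1r, addr0).

Fact free_addA i : associative (@free_add i).
Proof.
by move=> x y z; apply: free_eval_inj => Y phi; rewrite !evalE addrA.
Qed.
Fact free_addC i : commutative (@free_add i).
Proof. by move=> x y; apply: free_eval_inj => Y phi; rewrite !evalE addrC. Qed.
Fact free_add0 i : left_id (free_zero i) (@free_add i).
Proof. by move=> x; apply: free_eval_inj => Y phi; rewrite !evalE add0r. Qed.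
Fact free_addN i : left_inverse (free_zero i) (@free_opp i) (@free_add i).
Proof. by move=> x; apply: free_eval_inj => Y phi; rewrite !evalE addNr. Qed.
HB.instance Definition _ i := GRing.isZmodule.Build (free_sp i)
  (@free_addA i) (@free_addC i) (@free_add0 i) (@free_addN i).

Fact free_scaleA i a b (z : free_sp i) :
  free_scale a (free_scale b z) = free_scale (a * b) z.
Proof. by apply: free_eval_inj => Y phi; rewrite !evalE scalerA. Qed.
Fact free_scale1 i : left_id 1 (@free_scale i).
Proof. by move=> z; apply: free_eval_inj => Y phi; rewrite !evalE. Qed.
Fact free_scaleDr i : right_distributive (@free_scale i) +%R.
Proof.
move=> c y z; apply: free_eval_inj => Y phi.
by rewrite !evalE scalerDr.
Qed.
Fact free_scaleDl i (z : free_sp i) :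
  {morph (@free_scale i)^~ z : a b / a + b}.
Proof.
by move=> a b; apply: free_eval_inj => Y phi; rewrite !evalE scalerDl.
Qed.
HB.instance Definition _ i := GRing.Zmodule_isLmodule.Build F (free_sp i)
  (@free_scaleA i) (@free_scale1 i) (@free_scaleDr i) (@free_scaleDl i).

Lemma free_linE i c (y z : free_sp i) : c *: y + z = free_lin c y z.
Proof. by apply: free_eval_inj => Y phi; rewrite !evalE. Qed.

Definition free_act a (z : free_sp (src a)) : free_sp (tgt a) :=
  free_class (FAct (free_repr z)).
Lemma free_eval_act Y phi a z :
  @free_eval Y phi _ (free_act z) = qmor Y a (free_eval phi z).
Proof. exact: free_evalE. Qed.
Fact free_act_is_linear a : linear (@free_act a).
Proof.
move=> c y z; apply: free_eval_inj => Y phi; rewrite !free_linE.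
by rewrite free_eval_act !free_eval_lin !free_eval_act linearP.
Qed.
HB.instance Definition _ a := GRing.isLinear.Build F (free_sp (src a))
  (free_sp (tgt a)) _ (@free_act a) (@free_act_is_linear a).

Definition free_qrep : qrep F Q :=
  @QRep F Q free_sp (fun a => @free_act a : {linear _ -> _}).

Definition free_gen i (v : V i) : free_sp i := free_class (FGen v).
Fact free_gen_is_linear i : linear (@free_gen i).
Proof.
move=> c u v; apply: free_eval_inj => Y phi; rewrite free_linE.
by rewrite free_eval_lin !free_evalE /= linearP.
Qed.
HB.instance Definition _ i := GRing.isLinear.Build F (V i) (free_sp i) _
  (@free_gen i) (@free_gen_is_linear i).

Lemma free_ind (P : forall i, free_sp i -> Prop) :
  (forall i v, P i (free_gen v)) ->
  (forall a z, P (src a) z -> P (tgt a) (free_act z)) ->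
  (forall i c y z, P i y -> P i z -> P i (c *: y + z)) ->
  forall i z, P i z.
Proof.
move=> Pgen Pact Plin i z; rewrite -[z]free_reprK.
elim: (free_repr z) => {i z} [i v|a t IH|i c t IHt u IHu]; first exact: Pgen.
  suff -> : free_class (FAct t) = free_act (free_class t) by apply: Pact.
  by apply: free_eval_inj => Y phi; rewrite free_eval_act !free_evalE.
suff -> : free_class (FLin c t u) = c *: free_class t + free_class u.
  exact: Plin.
apply: free_eval_inj => Y phi.
by rewrite free_linE free_eval_lin !free_evalE.
Qed.

Section Lift.
Variables (Y : qrep F Q) (phi : forall i, {linear V i -> Y i}).

Fact free_eval_is_linear i : linear (@free_eval Y phi i).
Proof. by move=> c y z; rewrite free_linE free_eval_lin. Qed.
HB.instance Definition _ i := GRing.isLinear.Build F (free_sp i) (Y i) _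
  (@free_eval Y phi i) (@free_eval_is_linear i).

Definition free_lift : qhom free_qrep Y :=
  @QHom F Q free_qrep Y (fun i => @free_eval Y phi i : {linear _ -> _})
    (@free_eval_act Y phi).

Lemma free_liftE i v : free_lift i (free_gen v) = phi i v.
Proof. exact: free_evalE. Qed.

End Lift.

End FreeRepresentation.

(** * Cochains and homomorphisms from the syzygy *)

Section Kernel.
Variables (R : nzRingType) (V W : lmodType R) (f : {linear V -> W}).
Definition kernel_pred : {pred V} := fun x => f x == 0.
Fact kernel_submod_closed : submod_closed kernel_pred.
Proof.
split=> [|c x y]; rewrite !unfold_in /kernel_pred ?linear0 //.
by move=> /eqP x0 /eqP y0; rewrite linearP x0 y0 scaler0 addr0.
Qed.
HB.instance Definition _ :=
  GRing.isSubmodClosed.Build R V kernel_pred kernel_submod_closed.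
End Kernel.

Section Derivation.
Variables (F : fieldType) (Q : quiver) (X Y : qrep F Q).

Definition free_counit : qhom (free_qrep X) X :=
  free_lift (fun i => idfun : {linear X i -> X i}).

Variable gamma : forall a, {linear X (src a) -> Y (tgt a)}.

(* The extension of X by Y with class gamma; its universal lift from the free *)
(* representation has the derivation of gamma as first component.             *)
Definition extension_act a (u : Y (src a) * X (src a)) :
    Y (tgt a) * X (tgt a) :=
  (qmor Y a u.1 + gamma a u.2, qmor X a u.2).
Fact extension_act_is_linear a : linear (@extension_act a).
Proof.
move=> c u v; rewrite /extension_act /= !linearP; congr pair.
by rewrite /= scalerDr addrACA.
Qed.
HB.instance Definition _ a := GRing.isLinear.Build F
  (Y (src a) * X (src a))%type (Y (tgt a) * X (tgt a))%type _
  (@extension_act a) (@extension_act_is_linear a).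

Definition extension_qrep : qrep F Q :=
  @QRep F Q (fun i => (Y i * X i)%type)
    (fun a => @extension_act a : {linear _ -> _}).

Definition extension_sec i (x : X i) : extension_qrep i := (0, x).
Fact extension_sec_is_linear i : linear (@extension_sec i).
Proof. by move=> c u v; congr pair; rewrite /= scaler0 addr0. Qed.
HB.instance Definition _ i := GRing.isLinear.Build F (X i)
  (extension_qrep i) _ (@extension_sec i) (@extension_sec_is_linear i).

Let lift : qhom (free_qrep X) extension_qrep :=
  free_lift (fun i => @extension_sec i : {linear X i -> extension_qrep i}).

Definition derivation i (z : free_qrep X i) : Y i := (lift i z).1.
Fact derivation_is_linear i : linear (@derivation i).
Proof. by move=> c u v; rewrite /derivation linearP. Qed.
HB.instance Definition _ i := GRing.isLinear.Build F (free_qrep X i) (Y i) _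
  (@derivation i) (@derivation_is_linear i).

Lemma derivation_gen i (x : X i) : derivation (free_gen x) = 0.
Proof. by rewrite /derivation /lift free_liftE. Qed.

(** The second component of [lift] is the counit. On the kernel of the counit the term in gamma
    drops out, so there the derivation commutes with the arrows. *)
Lemma derivation_act a (z : free_qrep X (src a)) :
  derivation (qmor (free_qrep X) a z) =
  qmor Y a (derivation z) + gamma a (free_counit (src a) z).
Proof.
rewrite /derivation (qhom_comm lift) /=; congr (_ + gamma a _).
elim/free_ind: {a} (src a) / z => [i x|a z IH|i c y z IHy IHz].
- by rewrite /lift !free_liftE.
- by rewrite (qhom_comm lift) (qhom_comm free_counit) /= IH.
- by rewrite !linearP /= IHy IHz.
Qed.

Lemma derivation_uniq (G : forall i, {linear free_qrep X i -> Y i}) :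
  (forall i (x : X i), G i (free_gen x) = 0) ->
  (forall a (z : free_qrep X (src a)), G (tgt a) (qmor (free_qrep X) a z) =
     qmor Y a (G (src a) z) + gamma a (free_counit (src a) z)) ->
  forall i z, derivation z = G i z.
Proof.
move=> Ggen Gact; apply: free_ind => [i x|a z IH|i c y z IHy IHz].
- by rewrite Ggen derivation_gen.
- by rewrite derivation_act Gact IH.
- by rewrite !linearP /= IHy IHz.
Qed.

End Derivation.

(** Projectivity as a representation of A_(nu+1) in vector spaces, in the form of the lifting
    property. *)
Definition chain_projective (F : fieldType) nu (X : 'I_nu.+1 -> lmodType F)
    (sX : forall k : 'I_nu, X (step_src k) -> X (step_tgt k)) : Prop :=
  forall (Z Y : 'I_nu.+1 -> lmodType F)
    (sZ : forall k : 'I_nu, {linear Z (step_src k) -> Z (step_tgt k)})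
    (sY : forall k : 'I_nu, {linear Y (step_src k) -> Y (step_tgt k)})
    (q : forall k, {linear Z k -> Y k}) (f : forall k, {linear X k -> Y k}),
  (forall k z, q (step_tgt k) (sZ k z) = sY k (q (step_src k) z)) ->
  (forall k x, f (step_tgt k) (sX k x) = sY k (f (step_src k) x)) ->
  (forall k y, exists z, q k z = y) ->
  exists g : forall k, {linear X k -> Z k},
    (forall k x, g (step_tgt k) (sX k x) = sZ k (g (step_src k) x)) /\
    forall k x, q k (g k x) = f k x.

Section FreeResolution.
Variables (F : fieldType) (Q : quiver) (nu : nat) (X : qseq F Q nu).

Definition free_step (k : 'I_nu) :
    qhom (free_qrep (X (step_src k))) (free_qrep (X (step_tgt k))) :=
  free_lift (Y := free_qrep (X (step_tgt k)))
    (fun i => @free_gen F Q (X (step_tgt k)) i \o qseq_step X k i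
       : {linear X (step_src k) i -> free_qrep (X (step_tgt k)) i}).

Definition free_qseq : qseq F Q nu :=
  @QSeq F Q nu (fun k => free_qrep (X k)) free_step.

Lemma free_step_gen k i (x : X (step_src k) i) :
  free_step k i (free_gen x) = free_gen (qseq_step X k i x).
Proof. exact: free_liftE. Qed.

Lemma counit_step (k : 'I_nu) i (z : free_qrep (X (step_src k)) i) :
  free_counit (X (step_tgt k)) i (free_step k i z) =
  qseq_step X k i (free_counit (X (step_src k)) i z).
Proof.
elim/free_ind: i / z => [i x|a z IH|i c y z IHy IHz].
- by rewrite free_step_gen /free_counit !free_liftE.
- rewrite (qhom_comm (free_step k)) (qhom_comm (free_counit _)) IH.
  by rewrite (qhom_comm (free_counit _)) (qhom_comm (qseq_step X k)).
- by rewrite !linearP IHy IHz.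
Qed.

Definition counit_hom : qseq_hom free_qseq X :=
  @QSeqHom F Q nu free_qseq X (fun k => free_counit (X k)) counit_step.

Fact counit_kernel_arr k (a : arr Q) (z : free_qseq k (src a)) :
  z \in kernel_pred (free_counit (X k) (src a)) ->
  qmor (free_qseq k) a z \in kernel_pred (free_counit (X k) (tgt a)).
Proof.
rewrite !unfold_in /kernel_pred => /eqP z0.
by rewrite (qhom_comm (free_counit _)) z0 linear0.
Qed.

Fact counit_kernel_step (k : 'I_nu) i (z : free_qseq (step_src k) i) :
  z \in kernel_pred (free_counit (X (step_src k)) i) ->
  qseq_step free_qseq k i z \in kernel_pred (free_counit (X (step_tgt k)) i).
Proof.
rewrite !unfold_in /kernel_pred => /eqP z0.
by rewrite counit_step z0 linear0.
Qed.

Definition counit_kernel : subqseq free_qseq :=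
  @SubQSeq F Q nu free_qseq (fun k i => kernel_pred (free_counit (X k) i))
    counit_kernel_arr counit_kernel_step.

Definition syzygy : qseq F Q nu := sub_qseq counit_kernel.

Definition syzygy_incl : qseq_hom syzygy free_qseq :=
  @QSeqHom F Q nu syzygy free_qseq
    (fun k => @QHom F Q (syzygy k) (free_qseq k)
       (fun i => @subm_incl F (free_qrep (X k) i) (counit_kernel k i)
          : {linear _ -> _}) (fun a x => erefl))
    (fun k i x => erefl).

Lemma syzygy_exact :
  @short_exact F (FQA_mod F Q nu) syzygy free_qseq X syzygy_incl counit_hom.
Proof.
split=> [[k i] w1 w2|[k i] x|[k i] z] /=; first exact: val_inj.
  by exists (free_gen (x : X k i)); rewrite /free_counit free_liftE.
split=> [z0|[w <-]]; last by apply/eqP; exact: (valP w).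
have zK : z \in (counit_kernel k i) by rewrite unfold_in; apply/eqP.
by exists (exist _ z zK).
Qed.

Section FreeLift.
Variables (Y : qseq F Q nu) (phi : forall k i, {linear X k i -> Y k i}).
Hypothesis phiC : forall (k : 'I_nu) i (x : X (step_src k) i),
  phi (step_tgt k) i (qseq_step X k i x) =
  qseq_step Y k i (phi (step_src k) i x).

Fact free_qseq_lift_step (k : 'I_nu) i (z : free_qseq (step_src k) i) :
  free_lift (Y := Y (step_tgt k)) (phi (step_tgt k)) i
    (qseq_step free_qseq k i z) =
  qseq_step Y k i (free_lift (Y := Y (step_src k)) (phi (step_src k)) i z).
Proof.
elim/free_ind: i / z => [i x|a z IH|i c y z IHy IHz].
- by rewrite /= free_step_gen !free_liftE phiC.
- rewrite (qhom_comm (free_step k)) (qhom_comm (free_lift _)) IH.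
  by rewrite (qhom_comm (free_lift _)) (qhom_comm (qseq_step Y k)).
- by rewrite !linearP /= IHy IHz.
Qed.

Definition free_qseq_lift : qseq_hom free_qseq Y :=
  @QSeqHom F Q nu free_qseq Y (fun k => free_lift (Y := Y k) (phi k))
    free_qseq_lift_step.

Lemma free_qseq_liftE k i (x : X k i) :
  free_qseq_lift k i (free_gen x) = phi k i x.
Proof. exact: free_liftE. Qed.

End FreeLift.

(** A morphism out of a free sequence is determined by its values on generators, so it suffices to
    lift the chain of vector spaces at each vertex of Q separately. *)
Lemma free_qseq_projective :
  (forall i,
     @chain_projective F nu (fun k => X k i) (fun k => qseq_step X k i)) ->
  @projective F (FQA_mod F Q nu) free_qseq.
Proof.
move=> projX Z Y q f qsurj.
have lift i : exists g : forall k, {linear X k i -> Z k i},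
    (forall k x, g (step_tgt k) (qseq_step X k i x) =
       qseq_step Z k i (g (step_src k) x)) /\
    forall k x, q k i (g k x) = f k i (free_gen x).
  apply: (projX i (fun k => Z k i) (fun k => Y k i)
    (fun k => qseq_step Z k i) (fun k => qseq_step Y k i) (fun k => q k i)
    (fun k => f k i \o @free_gen F Q (X k) i : {linear _ -> _})).
  - by move=> k z; apply: qseq_hom_comm.
  - move=> k x /=; rewrite -free_step_gen.
    exact: (@qseq_hom_comm _ _ _ free_qseq Y f).
  - by move=> k y; apply: (qsurj (k, i)).
have /fin_all_exists [g gP] := lift.
exists (@free_qseq_lift Z (fun k i => g i k) (fun k i x => (gP i).1 k x)).
move=> -[k i] /= z.
elim/free_ind: i / z => [i x|a z IH|i c y z IHy IHz].
- by rewrite free_liftE (gP i).2.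
- by rewrite (qhom_comm (free_lift _)) (qhom_comm (q _)) IH (qhom_comm (f _)).
- by rewrite !linearP /= IHy IHz.
Qed.

Section Cochains.
Variable Y : qseq F Q nu.

Definition cochain := forall k (a : arr Q), {linear X k (src a) -> Y k (tgt a)}.
(** Only compatibility with the steps is asked: the arrows of Q satisfy no relations, so the
    components at different arrows are independent. *)
Definition is_cocycle (gamma : cochain) : Prop :=
  forall k a (x : X (step_src k) (src a)),
    gamma (step_tgt k) a (qseq_step X k (src a) x) =
    qseq_step Y k (tgt a) (gamma (step_src k) a x).

Definition is_coboundary (gamma : cochain) : Prop :=
  exists phi : forall k i, {linear X k i -> Y k i},
    (forall k i x, phi (step_tgt k) i (qseq_step X k i x) =
       qseq_step Y k i (phi (step_src k) i x)) /\
    forall k a x, gamma k a x =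
      qmor (Y k) a (phi k (src a) x) - phi k (tgt a) (qmor (X k) a x).

Section Hom.
Variables (gamma : cochain) (gammaC : is_cocycle gamma).

Lemma derivation_step (k : 'I_nu) i (z : free_qrep (X (step_src k)) i) :
  derivation (gamma (step_tgt k)) (free_step k i z) =
  qseq_step Y k i (derivation (gamma (step_src k)) z).
Proof.
elim/free_ind: i / z => [i x|a z IH|i c y z IHy IHz].
- by rewrite free_step_gen !derivation_gen linear0.
- rewrite (qhom_comm (free_step k)) !derivation_act IH linearD /=.
  by rewrite (qhom_comm (qseq_step Y k)) counit_step gammaC.
- by rewrite !linearP /= IHy IHz.
Qed.

Definition syzygy_fun k i (w : syzygy k i) : Y k i :=
  derivation (gamma k) (subm_incl w).
Fact syzygy_fun_is_linear k i : linear (@syzygy_fun k i).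
Proof. by move=> c u v; rewrite /syzygy_fun !linearP. Qed.
HB.instance Definition _ k i := GRing.isLinear.Build F (syzygy k i) (Y k i) _
  (@syzygy_fun k i) (@syzygy_fun_is_linear k i).

Fact syzygy_fun_act k a (w : syzygy k (src a)) :
  syzygy_fun (qmor (syzygy k) a w) = qmor (Y k) a (syzygy_fun w).
Proof.
rewrite /syzygy_fun -[subm_incl _]/(qmor (free_qseq k) a (subm_incl w)).
by rewrite derivation_act (eqP (valP w)) linear0 addr0.
Qed.

Fact syzygy_fun_step (k : 'I_nu) i (w : syzygy (step_src k) i) :
  syzygy_fun (qseq_step syzygy k i w) = qseq_step Y k i (syzygy_fun w).
Proof. exact: derivation_step. Qed.

Definition syzygy_hom : qseq_hom syzygy Y :=
  @QSeqHom F Q nu syzygy Y (fun k => @QHom F Q (syzygy k) (Y k)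
    (fun i => @syzygy_fun k i : {linear _ -> _}) (@syzygy_fun_act k))
    syzygy_fun_step.

End Hom.

End Cochains.
End FreeResolution.

(** * Ext^1 as cocycles modulo coboundaries *)

Lemma quotient_basis (F : fieldType) n (D : 'M[F]_n) :
  exists B : 'M[F]_(n - \rank D, n),
    (forall v : 'rV_n, exists c : 'rV_(n - \rank D), (v - c *m B <= D)%MS) /\
    forall c : 'rV_(n - \rank D), (c *m B <= D)%MS -> c = 0.
Proof.
rewrite -(mxrank_compl D); exists (row_base D^C)%MS; split=> [v|c cD].
  have : (v <= D + D^C)%MS by apply: submx_full; apply: addsmx_compl_full.
  case/sub_addsmxP=> -[u w] /= ->.
  have : (w *m D^C <= row_base D^C)%MS by rewrite eq_row_base submxMl.
  by case/submxP=> c ->; exists c; rewrite addrK submxMl.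
have : (c *m row_base D^C <= D :&: D^C)%MS.
  by rewrite sub_capmx cD (submx_trans (submxMl _ _)) // eq_row_base.
rewrite capmx_compl submx0 => /eqP c0.
by apply: (row_free_inj (row_base_free D^C%MS)); rewrite mul0mx.
Qed.

Lemma free_gen0 (F : fieldType) (Q : quiver) (V : vert Q -> lmodType F) i :
  @free_gen F Q V i 0 = 0.
Proof. exact: linear0. Qed.

Lemma linear_mul_row (F : fieldType) m n (V : lmodType F) (T : 'rV[F]_n -> V)
    (c : 'rV_m) (B : 'M_(m, n)) :
  linear T -> T (c *m B) = \sum_l c 0 l *: T (row l B).
Proof.
move=> linT.
pose TL : {linear 'rV[F]_n -> V} :=
  HB.pack T (GRing.isLinear.Build _ _ _ _ T linT).
rewrite -[T]/(TL : _ -> _) mulmx_sum_row linear_sum.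
by apply: eq_bigr => l _; rewrite linearZ.
Qed.

Section SyzygyGenerators.
Variables (F : fieldType) (Q : quiver) (nu : nat) (X : qseq F Q nu).

Fact syzygy_gen_kernel k (a : arr Q) (x : X k (src a)) :
  qmor (free_qseq X k) a (free_gen x) - free_gen (qmor (X k) a x)
    \in counit_kernel X k (tgt a).
Proof.
rewrite unfold_in /kernel_pred linearB (qhom_comm (free_counit (X k))).
by rewrite /free_counit !free_liftE subrr.
Qed.

(** The elements a[x] - [a x] of the standard resolution; a homomorphism out of the syzygy is
    determined by its values on them ([hom_cochainK]). *)
Definition syzygy_gen k (a : arr Q) (x : X k (src a)) : syzygy X k (tgt a) :=
  exist (fun z => z \in counit_kernel X k (tgt a)) _ (syzygy_gen_kernel x).
Fact syzygy_gen_is_linear k a : linear (@syzygy_gen k a).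
Proof.
move=> c u v; apply: val_inj; rewrite /= !linearP /=.
by rewrite scalerDr addrACA.
Qed.
HB.instance Definition _ k a := GRing.isLinear.Build F (X k (src a))
  (syzygy X k (tgt a)) _ (@syzygy_gen k a) (@syzygy_gen_is_linear k a).

Fact syzygy_retract_kernel k i (z : free_qseq X k i) :
  z - free_gen (free_counit (X k) i z) \in counit_kernel X k i.
Proof.
by rewrite unfold_in /kernel_pred linearB /free_counit free_liftE subrr.
Qed.

Definition syzygy_retract k i (z : free_qseq X k i) : syzygy X k i :=
  exist (fun z => z \in counit_kernel X k i) _ (syzygy_retract_kernel z).
Fact syzygy_retract_is_linear k i : linear (@syzygy_retract k i).
Proof.
move=> c u v; apply: val_inj; rewrite /= !linearP /=.
by rewrite scalerDr addrACA.
Qed.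
HB.instance Definition _ k i := GRing.isLinear.Build F (free_qseq X k i)
  (syzygy X k i) _ (@syzygy_retract k i) (@syzygy_retract_is_linear k i).

Variable Y : qseq F Q nu.

Lemma syzygy_fun_gen (gamma : cochain X Y) k a (x : X k (src a)) :
  syzygy_fun gamma (syzygy_gen x) = gamma k a x.
Proof.
rewrite /syzygy_fun /= linearB /= derivation_act !derivation_gen.
by rewrite linear0 add0r subr0 /free_counit free_liftE.
Qed.

Definition hom_cochain (g : qseq_hom (syzygy X) Y) : cochain X Y :=
  fun k a => g k (tgt a) \o @syzygy_gen k a : {linear _ -> _}.

Lemma hom_cochain_cocycle g : is_cocycle (hom_cochain g).
Proof.
move=> k a x; rewrite /hom_cochain /= -(qseq_hom_comm g); congr (g _ _ _).
apply: val_inj; rewrite /= linearB /= free_step_gen.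
rewrite (qhom_comm (free_step X k)) free_step_gen.
by rewrite (qhom_comm (qseq_step X k)).
Qed.

(** The composite of [g] with the linear retraction z -> z - [counit z] obeys the rule in
    [derivation_uniq], and the retraction is the identity on the syzygy. *)
Lemma hom_cochainK (g : qseq_hom (syzygy X) Y) k i (w : syzygy X k i) :
  g k i w = syzygy_fun (hom_cochain g) w.
Proof.
rewrite /syzygy_fun (@derivation_uniq _ _ _ _ _
  (fun i => g k i \o @syzygy_retract k i : {linear _ -> _})) /=.
- congr (g k i _); apply: val_inj => /=.
  by rewrite (eqP (valP w)) free_gen0 subr0.
- move=> j x; rewrite -[RHS](linear0 (g k j)); congr (g k j _).
  by apply: val_inj; rewrite /= /free_counit free_liftE subrr.
move=> a z; rewrite -(qhom_comm (g k)) -linearD; congr (g k _ _).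
apply: val_inj; rewrite /= (qhom_comm (free_counit _)) linearB /=.
by rewrite addrA subrK.
Qed.

Lemma eq_syzygy_fun (gamma gamma' : cochain X Y) :
  (forall k a x, gamma k a x = gamma' k a x) ->
  forall k i (w : syzygy X k i), syzygy_fun gamma w = syzygy_fun gamma' w.
Proof.
move=> eq_gamma k i w; rewrite /syzygy_fun.
apply: (@derivation_uniq _ _ _ _ _ (fun i => @derivation _ _ _ _ (gamma' k) i
  : {linear _ -> _})) => /= [j x|a z]; first exact: derivation_gen.
by rewrite derivation_act eq_gamma.
Qed.

Lemma syzygy_fun_lin (gamma gamma1 gamma2 : cochain X Y) c :
  (forall k a x, gamma k a x = c *: gamma1 k a x + gamma2 k a x) ->
  forall k i (w : syzygy X k i),
    syzygy_fun gamma w = c *: syzygy_fun gamma1 w + syzygy_fun gamma2 w.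
Proof.
move=> gammaE k i w; rewrite /syzygy_fun.
pose G j := (c \*: @derivation _ _ _ _ (gamma1 k) j
    \+ @derivation _ _ _ _ (gamma2 k) j)
  : {linear free_qrep (X k) j -> Y k j}.
rewrite (@derivation_uniq _ _ _ _ _ G) //= => [j x|a z].
  by rewrite !derivation_gen scaler0 addr0.
by rewrite !derivation_act gammaE linearP scalerDr addrACA.
Qed.

(** The map z -> h(z) - h([counit z]) obeys the derivation rule of [gamma], and its second term
    vanishes on the syzygy. *)
Lemma syzygy_fun_coboundary (gamma : cochain X Y)
    (h : qseq_hom (free_qseq X) Y) :
  (forall k a (x : X k (src a)), gamma k a x =
     qmor (Y k) a (h k (src a) (free_gen x))
       - h k (tgt a) (free_gen (qmor (X k) a x))) ->
  forall k i (w : syzygy X k i), syzygy_fun gamma w = h k i (subm_incl w).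
Proof.
move=> gammaE k i w; rewrite /syzygy_fun.
pose G j := (h k j \- (h k j \o (@free_gen F Q (X k) j \o free_counit (X k) j)))
  : {linear free_qrep (X k) j -> Y k j}.
rewrite (@derivation_uniq _ _ _ _ _ G) /=.
- by rewrite (eqP (valP w)) free_gen0 linear0 subr0.
- by move=> j x; rewrite /= /free_counit free_liftE subrr.
move=> a z; rewrite /= (qhom_comm (h k)) (qhom_comm (free_counit _)).
by rewrite linearB gammaE addrA subrK.
Qed.

End SyzygyGenerators.

Section ExtDimension.
Variables (F : fieldType) (Q : quiver) (nu : nat) (X Y : qseq F Q nu).

(** [theta] induces an isomorphism from F^N / D to cocycles modulo coboundaries: its kernel lies in
    [D], as the zero cochain is a coboundary. The basis of Ext^1 is the image of a basis of a
    complement of [D]. *)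
Lemma ext1_dim_cocycles N (D : 'M[F]_N)
    (theta : 'rV[F]_N ->
       forall k (a : arr Q), {linear X k (src a) -> Y k (tgt a)}) :
  (forall i,
     @chain_projective F nu (fun k => X k i) (fun k => qseq_step X k i)) ->
  (forall c u v k a x,
     theta (c *: u + v) k a x = c *: theta u k a x + theta v k a x) ->
  (forall v, is_cocycle (theta v)) ->
  (forall gamma : cochain X Y, is_cocycle gamma ->
     exists v, forall k a x, gamma k a x = theta v k a x) ->
  (forall v, (v <= D)%MS <-> is_coboundary (theta v)) ->
  ext1_dim (FQA_mod F Q nu) X Y (N - \rank D).
Proof.
move=> projX theta_lin thetaC theta_surj theta_cob.
have [B [Bspan Bfree]] := quotient_basis D.
exists (syzygy X), (free_qseq X), (syzygy_incl X), (counit_hom X).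
split; [exact: free_qseq_projective|exact: syzygy_exact|].
exists (fun l => syzygy_hom (thetaC (row l B))) => g.
have [v vE] := theta_surj _ (hom_cochain_cocycle g).
have [c vcD] := Bspan v.
have evalE k i (w : syzygy X k i) (u : 'rV_(N - \rank D)) :
    \sum_(l < N - \rank D) u 0 l *: syzygy_fun (theta (row l B)) w =
    syzygy_fun (theta (u *m B)) w.
  rewrite -(linear_mul_row (T := fun t => syzygy_fun (theta t) w)) // => b t t'.
  exact: syzygy_fun_lin.
exists c; split.
  have [phi [phiC phiE]] := (theta_cob _).1 vcD.
  exists (free_qseq_lift phiC) => -[k i] w.
  rewrite -[X in _ = _ + X]/(free_qseq_lift phiC k i (subm_incl w)).
  rewrite -(syzygy_fun_coboundary (gamma := theta (v - c *m B))); last first.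
    by move=> {w}k a x; rewrite phiE !free_qseq_liftE.
  rewrite [X in _ = X + _](evalE k i w c) -[LHS]/(g k i w).
  rewrite hom_cochainK (eq_syzygy_fun vE).
  rewrite (syzygy_fun_lin (gamma1 := theta (c *m B))
    (gamma2 := theta (v - c *m B)) (c := 1)) ?scale1r //.
  by move=> {w}k a x; rewrite -theta_lin scale1r addrC subrK.
move=> c' [h hE]; apply/eqP; rewrite -subr_eq0; apply/eqP/Bfree.
rewrite mulmxBl.
(* Evaluating the relation for [c'] on the elements [syzygy_gen x] exhibits v - c' B as a
   coboundary; then (c - c') B lies in [D], which forces c = c'. *)
have c'D : (v - c' *m B <= D)%MS.
  apply/theta_cob.
  exists (fun k i => h k i \o @free_gen F Q (X k) i : {linear _ -> _}).
  split=> [k i x|k a x] /=.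
    by rewrite -free_step_gen; exact: (@qseq_hom_comm _ _ _ (free_qseq X) Y h).
  have := hE (k, tgt a) (syzygy_gen x) => /=.
  rewrite evalE syzygy_fun_gen -[LHS]/(hom_cochain g k a x) vE /= linearB /=.
  rewrite (qhom_comm (h k)).
  have := theta_lin 1 (c' *m B) (v - c' *m B) k a x.
  by rewrite scale1r [_ + (v - _)]addrC subrK scale1r => -> /addrI.
have -> : c *m B - c' *m B = (v - c' *m B) - (v - c *m B).
  by rewrite opprB [RHS]addrC addrA subrK.
by rewrite addmx_sub // eqmx_opp.
Qed.

End ExtDimension.

(** * Split chains and flags *)

Lemma row_linear_lift (F : fieldType) n (Z Y : lmodType F) (q : {linear Z -> Y})
    (f : {linear 'rV[F]_n -> Y}) :
  (forall y, exists z, q z = y) ->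
  exists g : {linear 'rV[F]_n -> Z}, forall x, q (g x) = f x.
Proof.
move=> qsurj.
have /fin_all_exists [z zP] : forall j : 'I_n, exists z, q z = f (delta_mx 0 j).
  by move=> j; apply: qsurj.
pose g (x : 'rV[F]_n) := \sum_j x 0 j *: z j.
have linG : linear g.
  move=> c u v; rewrite /g scaler_sumr -big_split; apply: eq_bigr => j _.
  by rewrite !mxE scalerDl scalerA.
pose gL : {linear 'rV[F]_n -> Z} :=
  HB.pack g (GRing.isLinear.Build _ _ _ _ g linG).
exists gL => x; rewrite [in RHS](row_sum_delta x) !linear_sum.
by apply: eq_bigr => j _; rewrite !linearZ zP.
Qed.

Section SplitChain.
Variables (F : fieldType) (nu n : nat) (X : 'I_nu.+1 -> lmodType F).
Variable sX : forall k : 'I_nu, X (step_src k) -> X (step_tgt k).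
Variables (iX : forall k, {linear X k -> 'rV[F]_n}).
Variables (rX : forall k, {linear 'rV[F]_n -> X k}).
Hypothesis iXK : forall k, cancel (iX k) (rX k).
Hypothesis iX_step : forall k x, iX (step_tgt k) (sX x) = iX (step_src k) x.

(** The chain is an ascending chain of subspaces of F^n. The lift is built upwards, one level at a
    time, by maps defined on all of F^n so that the retractions can be used. *)
Lemma split_chain_projective : chain_projective sX.
Proof.
move=> Z Y sZ sY q f qC fC qsurj.
have /fin_all_exists [h hP] : forall k, exists g : {linear 'rV[F]_n -> Z k},
    forall x, q k (g x) = f k (rX k x).
  by move=> k; apply: (row_linear_lift (f k \o rX k : {linear _ -> _})).
have build m : (m <= nu)%N -> exists g : forall k, {linear 'rV[F]_n -> Z k},
    (forall k : 'I_nu.+1, (k <= m)%N -> forall x, q k (g k (iX k x)) = f k x) /\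
    (forall k : 'I_nu, (k < m)%N -> forall x,
       g (step_tgt k) (iX (step_src k) x) = sZ k (g (step_src k) (iX _ x))).
  elim: m => [|m IH] mnu; first by exists h; split=> // k _ x; rewrite hP iXK.
  have [g [gP gC]] := IH (ltnW mnu).
  pose k0 : 'I_nu := Ordinal mnu; pose s := step_src k0; pose t := step_tgt k0.
  (* [h t] lifts [f t], but may disagree with the previous level. The correction along the
     projection [iX s \o rX s] onto X_s makes them agree; [q] kills it on X_t since both maps lift
     the same values on X_s. *)
  pose new := h t \+ (((sZ k0 \o g s) \- h t) \o (iX s \o rX s))
    : {linear 'rV[F]_n -> Z t}.
  exists (dfwith g new); split=> [k km x|k km x].
    case: (eqVneq t k) => [tk|tk]; last first.
      rewrite dfwith_out // gP // -ltnS ltn_neqAle km andbT.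
      by apply: contra tk => /eqP e; apply/eqP/val_inj; rewrite /= e.
    case: k / tk km x => _ x; rewrite dfwith_in /new /=.
    rewrite linearD linearB hP iXK qC gP ?leqnSn //.
    by rewrite -fC hP -iX_step iXK subrr addr0.
  have src_neq : t != step_src k.
    by apply/eqP => /(congr1 val) /= e; move: km; rewrite -e ltnn.
  rewrite (dfwith_out _ _ src_neq).
  case: (eqVneq k0 k) => [kk0|kk0].
    case: k / kk0 km x src_neq => _ x _; rewrite dfwith_in /new /=.
    by rewrite iXK addrC subrK.
  rewrite dfwith_out ?gC //.
  rewrite ltn_neqAle -ltnS km andbT.
  by apply: contra kk0 => /eqP e; apply/eqP/val_inj; rewrite /= e.
have [g [gP gC]] := build nu (leqnn nu).
exists (fun k => g k \o iX k : {linear _ -> _}); split=> [k x|k x] /=.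
  by rewrite iX_step gC.
by rewrite gP // -ltnS.
Qed.

(** The steps are inclusions inside F^n, so a map to a constant chain is the restriction of its top
    component; the induction runs down from the top. *)
Lemma chain_map_const (W : lmodType F) (f : forall k, {linear X k -> W}) :
  (forall k x, f (step_tgt k) (sX x) = f (step_src k) x) ->
  forall k x, f k x = f ord_max (rX ord_max (iX k x)).
Proof.
move=> fC k; have [m mk] : exists m, (k + m)%N = nu.
  by exists (nu - k)%N; rewrite subnKC // -ltnS.
elim: m k mk => [|m IH] k mk x.
  have ek : k = ord_max by apply: val_inj; rewrite /= -[RHS]mk addn0.
  by move: x; rewrite ek => x; rewrite iXK.
have knu : (k < nu)%N.
  by apply: leq_trans (leq_addr m k.+1) _; rewrite addSn -addnS mk.
have ek : k = step_src (Ordinal knu) by apply: val_inj.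
move: x; rewrite ek => x; rewrite -fC IH ?iX_step //.
by rewrite -[RHS]mk /= addnS addSn.
Qed.

(** Projectivity lifts [f] through [q] to the constant chain F^m, where the top component gives the
    matrix. *)
Lemma chain_map_mx m (Y : 'I_nu.+1 -> lmodType F)
    (sY : forall k : 'I_nu, {linear Y (step_src k) -> Y (step_tgt k)})
    (q : forall k, {linear 'rV[F]_m -> Y k})
    (f : forall k, {linear X k -> Y k}) :
  (forall k y, q (step_tgt k) y = sY k (q (step_src k) y)) ->
  (forall k x, f (step_tgt k) (sX x) = sY k (f (step_src k) x)) ->
  (forall k y, exists z, q k z = y) ->
  exists G : 'M[F]_(n, m), forall k x, f k x = q k (iX k x *m G).
Proof.
move=> qC fC qsurj.
have [g [gC gP]] := @split_chain_projective (fun=> 'rV[F]_m) Y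
  (fun=> idfun : {linear _ -> _}) sY q f qC fC qsurj.
exists (lin1_mx (g ord_max \o rX ord_max)) => k x.
by rewrite mul_rV_lin1 /= -gP (chain_map_const gC).
Qed.

End SplitChain.

(** Take a matrix of maximal rank whose row space satisfies [P]; a vector of [P] outside it would
    raise the rank. *)
Lemma row_space_of_pred (F : fieldType) n (P : 'rV[F]_n -> Prop) :
  P 0 -> (forall c u v, P u -> P v -> P (c *: u + v)) ->
  exists D : 'M[F]_n, forall v, (v <= D)%MS <-> P v.
Proof.
move=> P0 Plin.
pose good r := `[< exists D : 'M[F]_n,
  \rank D = r /\ forall v : 'rV_n, (v <= D)%MS -> P v >].
have ex : exists r, good r.
  exists 0%N; apply/asboolP; exists 0; rewrite mxrank0; split=> // v.
  by rewrite submx0 => /eqP ->.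
have bnd r : good r -> (r <= n)%N.
  by case/asboolP=> D [<- _]; apply: rank_leq_row.
case: (ex_maxnP ex bnd) => r /asboolP [D [rD DP]] rmax; exists D => v.
split=> [/DP //|Pv]; apply/idPn => nvD.
have : good (\rank (D + v)%MS).
  apply/asboolP; exists (D + v)%MS; split=> // u /sub_addsmxP [[a b] /= ->].
  rewrite [b]mx11_scalar mul_scalar_mx addrC; apply: Plin => //.
  by apply: DP; apply: submxMl.
move/rmax; rewrite -rD leqNgt ltn_neqAle mxrankS ?addsmxSl // andbT negbK.
by rewrite (mxrank_leqif_sup (addsmxSl D v)) addsmx_sub (negPf nvD) andbF.
Qed.

Section SplitExt.
Variables (F : fieldType) (Q : quiver) (nu : nat) (n : vert Q -> nat).
Variable M : rep_pt F n.
Variables (X Y : qseq F Q nu).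
Variables (iX : forall k i, {linear X k i -> 'rV[F]_(n i)}).
Variables (rX : forall k i, {linear 'rV[F]_(n i) -> X k i}).
Variable q : forall k i, {linear 'rV[F]_(n i) -> Y k i}.
Hypothesis iXK : forall k i, cancel (iX k i) (rX k i).
Hypothesis iX_step : forall (k : 'I_nu) i (x : X (step_src k) i),
  iX (step_tgt k) i (qseq_step X k i x) = iX (step_src k) i x.
Hypothesis iX_act : forall k a (x : X k (src a)),
  iX k (tgt a) (qmor (X k) a x) = iX k (src a) x *m M a.
Hypothesis q_step : forall (k : 'I_nu) i y,
  q (step_tgt k) i y = qseq_step Y k i (q (step_src k) i y).
Hypothesis q_act : forall k a y,
  q k (tgt a) (y *m M a) = qmor (Y k) a (q k (src a) y).
Hypothesis q_surj : forall k i y, exists z, q k i z = y.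

(** By [chain_map_mx], cocycles and the maps phi of coboundaries all come from matrices. Being a
    coboundary thus means being a commutator with M up to a matrix that sends X into the kernel of
    [q]. *)
Lemma ext1_dim_split (D : 'M[F]_#|rep_coord n|) :
  (forall v, (v <= D)%MS <-> exists Z : forall i, 'M[F]_(n i),
     forall k a (x : X k (src a)), q k (tgt a)
       (iX k (src a) x *m
          (rep_of_row v a - (Z (src a) *m M a - M a *m Z (tgt a))))
       = 0) ->
  ext1_dim (FQA_mod F Q nu) X Y (#|rep_coord n| - \rank D).
Proof.
move=> DP.
pose theta (v : 'rV[F]_#|rep_coord n|) k a :
    {linear X k (src a) -> Y k (tgt a)} :=
  q k (tgt a) \o (mulmxr (rep_of_row v a) \o iX k (src a)).
have map_mx i j (f : forall k, {linear X k i -> Y k j}) :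
    (forall k x, f (step_tgt k) (qseq_step X k i x) =
       qseq_step Y k j (f (step_src k) x)) ->
    exists G : 'M[F]_(n i, n j), forall k x, f k x = q k j (iX k i x *m G).
  move=> fC.
  exact: (@chain_map_mx F nu (n i) (fun k => X k i) (fun k => qseq_step X k i)
    (fun k => iX k i) (fun k => rX k i) (fun k => @iXK k i)
    (fun k => @iX_step k i) (n j) (fun k => Y k j) (fun k => qseq_step Y k j)
    (fun k => q k j) f (fun k => @q_step k j) fC (fun k => @q_surj k j)).
apply: (@ext1_dim_cocycles F Q nu X Y _ D theta).
- move=> i; exact: (@split_chain_projective F nu (n i) (fun k => X k i)
    (fun k => qseq_step X k i) (fun k => iX k i) (fun k => rX k i)
    (fun k => @iXK k i) (fun k => @iX_step k i)).
- move=> c u v k a x; rewrite /theta /=.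
  by rewrite rep_of_row_is_linear mulmxDr -scalemxAr linearP.
- by move=> v k a x; rewrite /theta /= iX_step q_step.
- move=> gamma gammaC.
  have /fin_all_exists [G GP] a := map_mx _ _ (fun k => gamma k a)
    (fun k x => gammaC k a x).
  exists (row_of_rep G) => k a x.
  by rewrite GP /theta /= row_of_repK.
move=> v; rewrite DP; split=> [[Z ZP]|[phi [phiC phiE]]].
  exists (fun k i => q k i \o (mulmxr (Z i) \o iX k i)).
  split=> [k i x|k a x] /=.
    by rewrite iX_step q_step.
  have /eqP := ZP k a x; rewrite mulmxBr linearB subr_eq0 => /eqP.
  by rewrite /theta /= => ->; rewrite mulmxBr linearB !mulmxA q_act iX_act.
have /fin_all_exists [Z ZP] i := map_mx _ _ (fun k => phi k i)
  (fun k x => phiC k i x).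
exists Z => k a x; rewrite mulmxBr linearB.
have := phiE k a x; rewrite /theta /= => ->.
by rewrite !ZP mulmxBr linearB !mulmxA q_act iX_act subrr.
Qed.

End SplitExt.

(** Sequences over the one-element index set ['I_1] are representations, so Ext over FQ is the case
    nu = 0 of the same computation, read off at [ord0]. *)
Lemma ext1_dim_single (F : fieldType) (Q : quiver) (M N : qrep F Q) e :
  ext1_dim (FQA_mod F Q 0) (const_qseq 0 M) (const_qseq 0 N) e ->
  ext1_dim (FQ_mod F Q) M N e.
Proof.
have extend (A : qseq F Q 0) (B : qrep F Q) (f : qhom (A ord0) B) :
    exists g : qseq_hom A (const_qseq 0 B), g ord0 = f.
  pose g k : qhom (A k) B :=
    (* An index [k] of ['I_1] equals [ord0] only up to the proof [ord1 k], hence the cast. *)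
    ecast k (qhom (A k) B) (esym (ord1 k)) f.
  have gC : forall (k : 'I_0) i (x : A (step_src k) i),
      g (step_tgt k) i (qseq_step A k i x) = g (step_src k) i x by case.
  exists (@QSeqHom F Q 0 A (const_qseq 0 B) g gC).
  by rewrite /= /g (eq_irrelevance (esym (ord1 ord0)) erefl).
pose const_hom (A B : qrep F Q) (f : qhom A B) :
  qseq_hom (const_qseq 0 A) (const_qseq 0 B) :=
  @QSeqHom F Q 0 (const_qseq 0 A) (const_qseq 0 B) (fun=> f)
    (fun k i x => erefl).
move=> [W [P [j [p [projP [j_inj p_surj exact_jp] [f fP]]]]]].
exists (W ord0), (P ord0), (j ord0), (p ord0); split.
- move=> A B q g qsurj; have [g' g'E] := extend P B g.
  have [|h hP] := projP (const_qseq 0 A) (const_qseq 0 B) (const_hom A B q) g'.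
    by move=> [k i] y; apply: qsurj.
  exists (h ord0) => i x; have := hP (ord0, i) x; rewrite /= g'E; exact.
- by split=> [i|i y|i x]; [exact: (j_inj (ord0, i))|exact: (p_surj (ord0, i))|
    exact: (exact_jp (ord0, i))].
exists (fun l => f l ord0) => g; have [g' g'E] := extend W N g.
have [c [[h hP] c_uniq]] := fP g'; exists c; split.
  exists (h ord0) => i w; have := hP (ord0, i) w; rewrite /= g'E; exact.
move=> c' [h' h'P]; apply: c_uniq; have [h2 h2E] := extend P N h'.
exists h2 => -[k i] w /=; move: w; rewrite (ord1 k) => w.
by rewrite g'E h2E; apply: h'P.
Qed.

(** * The Ext groups of a flag *)

Section FlagExt.
Variables (F : fieldType) (Q : quiver) (nu : nat) (d : filtration Q nu).
Variable x : repfl F d.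
Let n := d ord_max.
Let M := rf_rep x.

(** The infinitesimal action of gl on M, up to sign. *)
Definition commutator_rep (Z : forall i, 'M[F]_(n i)) : rep_pt F n :=
  fun a => Z (src a) *m M a - M a *m Z (tgt a).

Lemma commutator_rep_lin c Z Z' a :
  commutator_rep (fun i => c *: Z i + Z' i) a =
  c *: commutator_rep Z a + commutator_rep Z' a.
Proof.
rewrite /commutator_rep mulmxDl mulmxDr -scalemxAl -scalemxAr scalerBr.
by rewrite opprD addrACA.
Qed.

Lemma flag_retract : exists rX : forall k i,
    {linear 'rV[F]_(n i) -> subm (rf_flag x k i)},
  forall k i u, rX k i (subm_incl u) = u.
Proof.
have h k i : exists r : {linear 'rV[F]_(n i) -> subm (rf_flag x k i)},
    forall u, r (subm_incl u) = u.
  have [B [_ BP]] : exists B : 'M[F]_(d k i, n i),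
      row_free B /\ forall u, (u \in rf_flag x k i) = (u <= B)%MS.
    by apply: has_rank_basis => *; exact: rf_rank.
  (* [pinvmx B *m B] projects onto the row space of [B]. *)
  have rin (y : 'rV[F]_(n i)) : y *m (pinvmx B *m B) \in rf_flag x k i.
    by rewrite BP mulmxA submxMl.
  pose r y : subm (rf_flag x k i) :=
    exist (fun y => y \in rf_flag x k i) _ (rin y).
  have rlin : linear r.
    by move=> c u v; apply: val_inj; rewrite /= mulmxDl -scalemxAl.
  pose rL : {linear 'rV[F]_(n i) -> subm (rf_flag x k i)} :=
    HB.pack r (GRing.isLinear.Build _ _ _ _ r rlin).
  exists rL => u; apply: val_inj; rewrite /= mulmxA mulmxKpV //.
  by rewrite -BP; exact: (valP u).
have {}h k : exists r : forall i, {linear 'rV[F]_(n i) -> subm (rf_flag x k i)},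
    forall i u, r i (subm_incl u) = u.
  by have /fin_all_exists := h k.
by have /fin_all_exists := h.
Qed.

Lemma flag_top i (u : 'rV[F]_(n i)) : u \in rf_flag x ord_max i.
Proof.
have [B [freeB BP]] : exists B : 'M[F]_(d ord_max i, n i),
    row_free B /\ forall u, (u \in rf_flag x ord_max i) = (u <= B)%MS.
  by apply: has_rank_basis => *; exact: rf_rank.
by rewrite BP submx_full // row_full_unit -row_free_unit.
Qed.

Lemma ext1_dim_flag (Y : qseq F Q nu)
    (q : forall k i, {linear 'rV[F]_(n i) -> Y k i})
    (D : 'M[F]_#|rep_coord n|) :
  (forall (k : 'I_nu) i y,
     q (step_tgt k) i y = qseq_step Y k i (q (step_src k) i y)) ->
  (forall k a y, q k (tgt a) (y *m M a) = qmor (Y k) a (q k (src a) y)) ->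
  (forall k i y, exists z, q k i z = y) ->
  (forall v, (v <= D)%MS <-> exists Z, forall k a (u : 'rV[F]_(n (src a))),
     u \in rf_flag x k (src a) ->
     q k (tgt a) (u *m (rep_of_row v a - commutator_rep Z a)) = 0) ->
  ext1_dim (FQA_mod F Q nu) (sub_qseq (rf_sub x)) Y (#|rep_coord n| - \rank D).
Proof.
move=> q_step q_act q_surj DP; have [rX rXK] := flag_retract.
apply: (@ext1_dim_split F Q nu n M (sub_qseq (rf_sub x)) Y
  (fun k i => @subm_incl _ _ (rf_flag x k i) : {linear _ -> _}) rX q) => //.
move=> v; rewrite DP; split=> -[Z ZP]; exists Z => k a u.
  by apply: ZP; exact: (valP u).
by move=> uU; exact: (ZP k a (exist _ u uU)).
Qed.

(** The space is Rep_U + [gl, M]; [Z] ranges over gl and the difference is the part that stabilises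
    the flag. *)
Lemma tangent_space_mx : exists D : 'M[F]_#|rep_coord n|, forall v,
  (v <= D)%MS <-> exists Z, forall k a (u : 'rV[F]_(n (src a))),
     u \in rf_flag x k (src a) ->
     u *m (rep_of_row v a - commutator_rep Z a) \in rf_flag x k (tgt a).
Proof.
apply: row_space_of_pred => [|c u v [Z ZP] [Z' Z'P]].
  exists (fun=> 0) => k a u uU.
  rewrite (_ : _ - _ = 0) ?mulmx0 ?rpred0 // /commutator_rep.
  by rewrite mul0mx mulmx0; apply/matrixP => i j; rewrite !mxE !subr0.
exists (fun i => c *: Z i + Z' i) => k a w wU.
rewrite rep_of_row_is_linear commutator_rep_lin opprD addrACA -scalerBr.
by rewrite mulmxDr -scalemxAr rpredD ?rpredZ ?ZP ?Z'P.
Qed.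

Lemma orbit_tangent_mx : exists D : 'M[F]_#|rep_coord n|, forall v,
  (v <= D)%MS <-> exists Z, forall a, rep_of_row v a = commutator_rep Z a.
Proof.
apply: row_space_of_pred => [|c u v [Z ZP] [Z' Z'P]].
  exists (fun=> 0) => a; rewrite /commutator_rep mul0mx mulmx0 subrr.
  by apply/matrixP => i j; rewrite !mxE.
exists (fun i => c *: Z i + Z' i) => a.
by rewrite rep_of_row_is_linear commutator_rep_lin ZP Z'P.
Qed.

End FlagExt.

Theorem theorem5p27 (K : fieldType) (Q : quiver) (nu : nat)
    (d : filtration Q nu) (F : fieldType) (iota : {rmorphism K -> F})
    (x : repfl F d) :
  let M : qrep F Q := rf_qrep x in
  let bM : qseq F Q nu := const_qseq nu M in
  let U : qseq F Q nu := sub_qseq (rf_sub x) in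
  let MU : qseq F Q nu := quot_qseq (rf_sub x) in
  exists c e1 e2 e3 : nat,
    [/\ is_codim (image_ideal K d) c,
        ext1_dim (FQA_mod F Q nu) U MU e1,
        ext1_dim (FQA_mod F Q nu) U bM e2,
        ext1_dim (FQ_mod F Q) M M e3 &
        [/\ (c <= e1)%N, (e1 <= e2)%N & (e2 <= e3)%N]].
Proof.
move=> M bM U MU.
have [D1 D1P] := tangent_space_mx x; have [D2 D2P] := orbit_tangent_mx x.
have [c codim_c le_c] : exists2 c, is_codim (image_ideal K d) c &
    (c <= #|rep_coord (d ord_max)| - \rank D1)%N.
  (* [codim_le_corank] uses M X - X M, the negative of [commutator_rep], hence the sign. *)
  apply: (codim_le_corank iota) => v /D1P [Z ZP]; exists (fun i => - Z i).
  move=> k a u uU; rewrite mulmxN mulNmx opprK [- _ + _]addrC; exact: ZP.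
exists c, (#|rep_coord (d ord_max)| - \rank D1)%N,
  (#|rep_coord (d ord_max)| - \rank D2)%N,
  (#|rep_coord (d ord_max)| - \rank D2)%N.
split=> //.
- apply: (@ext1_dim_flag _ _ _ _ x MU
    (fun k i => @qmod_pi _ _ (rf_flag x k i) : {linear _ -> _})) => //.
  + by move=> k i y; rewrite /= qmod_mapE.
  + by move=> k a y; rewrite /= qmod_mapE.
  + by move=> k i y; exists (repr y); exact: qmod_reprK.
  move=> v; rewrite D1P; split=> -[Z ZP]; exists Z => k a u uU.
    rewrite -[RHS](linear0 (@qmod_pi _ _ _)); apply/qmod_piP; rewrite subr0.
    exact: ZP.
  have := ZP k a u uU; rewrite -[X in _ = X -> _](linear0 (@qmod_pi _ _ _)).
  by move/qmod_piP; rewrite subr0.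
- apply: (@ext1_dim_flag _ _ _ _ x bM
    (fun k i => idfun : {linear _ -> _})) => //.
    by move=> k i y; exists y.
  move=> v; rewrite D2P; split=> -[Z ZP]; exists Z.
    by move=> k a u uU; rewrite ZP subrr mulmx0.
  (* At [ord_max] the flag is the whole space, so vanishing on it means that the matrix is zero. *)
  move=> a; apply/eqP; rewrite -subr_eq0; apply/eqP/row_matrixP => j.
  by rewrite rowE row0; apply: (ZP ord_max); exact: flag_top.
- apply: ext1_dim_single.
  pose id_mx (i : vert Q) :=
    idfun : {linear 'rV[F]_(d ord_max i) -> 'rV[F]_(d ord_max i)}.
  apply: (@ext1_dim_split F Q 0 (d ord_max) (rf_rep x) (const_qseq 0 M)
    (const_qseq 0 M) (fun=> id_mx) (fun=> id_mx) (fun=> id_mx)) => //.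
    by move=> k i y; exists y.
  move=> v; rewrite D2P; split=> -[Z ZP]; exists Z.
    by move=> k a u; rewrite /= ZP subrr mulmx0.
  move=> a; apply/eqP; rewrite -subr_eq0; apply/eqP/row_matrixP => j.
  by rewrite rowE row0; exact: (ZP ord0).
(* For a commutator the remaining part is 0, which stabilises every flag; so [D2] lies in [D1]. *)
split=> //; apply: leq_sub2l; apply: mxrankS; apply/row_subP => j.
apply/D1P; have /D2P [Z ZP] := row_sub j D2; exists Z => k a u uU.
by rewrite ZP subrr mulmx0 rpred0.
Qed.
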